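(* Let $d=1$, $m>0$, $\gamma\in[0,1)$ and $f(x)=e^{-m|x|}|x|^{-\gamma}$, $x\in\mathbb{R}$. Let $M_2:=(C_1\vee C_2)\|f\|_1$, where $C_1,C_2\ge1$ are constants such that $f(x)\le C_1f(y)$ for $1\le|x|\le|y|\le|x|+1$ and $f(x)\le C_2f(2x)$ for $|x|\le1$. Then the following estimates hold. (1) For $|x|\ge1$ and $n\in\mathbb{N}$, $$\frac{\Gamma(1-\gamma)^n}{\Gamma((1-\gamma)n)}\le\frac{f^{n\star}(x)}{f(x)|x|^{(1-\gamma)(n-1)}}\le\frac{\Gamma(1-\gamma)^n}{\Gamma((1-\gamma)n)}+\frac{2M_2\,n\,(M_2+\Gamma(1-\gamma))^{n-1}}{|x|^{1-\gamma}}.$$ In particular, $$\lim_{|x|\to\infty}\frac{f^{n\star}(x)}{f(x)|x|^{(1-\gamma)(n-1)}}=\lim_{|x|\to\infty}\frac{f^{n\star}(x)}{e^{-m|x|}|x|^{(1-\gamma)n-1}}=\frac{\Gamma(1-\gamma)^n}{\Gamma((1-\gamma)n)}.$$ (2) For $|x|\ge1$ and $\lambda>0$, $$1\le\frac{p_\lambda(x)}{e^{-\lambda\|f\|_1}e^{-m|x|}|x|^{-1}\phi\big(1-\gamma,0;\Gamma(1-\gamma)\lambda|x|^{1-\gamma}\big)}\le e^{M_2\lambda}.$$ In particular, there are positive constants $E_1,E_2,E_3,E_4$ (depending on $\gamma$ and on the fixed density $f$, but not on $x$ or $\lambda$) such that, for all $|x|\ge1$ and $\lambda>0$: if $\lambda|x|^{1-\gamma}\le1$,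 then $$E_1\le\frac{p_\lambda(x)}{\lambda e^{-\lambda\|f\|_1}e^{-m|x|}|x|^{-\gamma}}\le E_2;$$ if $\lambda|x|^{1-\gamma}\ge1$, then $$E_3\le\frac{p_\lambda(x)}{\lambda^{\frac{1}{4-2\gamma}}|x|^{-\frac{3-\gamma}{4-2\gamma}}\exp\left(-\lambda\|f\|_1-m|x|+\frac{2-\gamma}{1-\gamma}\big(\Gamma(2-\gamma)\lambda|x|^{1-\gamma}\big)^{\frac{1}{2-\gamma}}\right)}\le E_4e^{M_2\lambda}.$$
   Context: $\mathbb{N}=\{1,2,\dots\}$, $a\vee b=\max(a,b)$, $\|f\|_1$ is the $L^1(\mathbb{R})$ norm, $f(0)=\infty$ if $\gamma>0$. Constants $C_1,C_2$ as in the claim always exist for such $f$. Convolutions: $f^{1\star}:=f$, $f^{n\star}(x):=\int_{\mathbb{R}}f(x-y)f^{(n-1)\star}(y)\,dy$ for $n\ge2$. For $\lambda>0$ the density of the compound Poisson measure built for $f$ is $$p_\lambda(x)=e^{-\lambda\|f\|_1}\sum_{n=1}^\infty\frac{\lambda^nf^{n\star}(x)}{n!}.$$ Generalized Bessel (Wright) function: $\phi(\rho,\beta;t):=\sum_{n=0}^\infty\frac{t^n}{\Gamma(\rho n+\beta)\,n!}$ for $\rho>0$, $\beta\ge0$, $t>0$, with the convention $1/\Gamma(0)=0$. *)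

(* Defs.v *)
From HB Require Import structures.
From mathcomp Require Import all_boot all_order all_algebra.
From mathcomp Require Import all_classical all_reals all_analysis.

Set Implicit Arguments.
Unset Strict Implicit.
Unset Printing Implicit Defensive.

Import Order.TTheory GRing.Theory Num.Theory.
Import numFieldNormedType.Exports.

Local Open Scope classical_set_scope.
Local Open Scope ring_scope.

(* f(x) = e^{-m|x|} |x|^{-g}. The value at 0 is explicit because powR gives
   0 `^ (- g) = 0 for g != 0, whereas f(0) = +oo when g > 0. *)
Definition profile {R : realType} (m g : R) (x : R) : \bar R :=
  if (x == 0) && (0 < g) then +oo%E
  else (expR (- m * `|x|) * `|x| `^ (- g))%:E.

Definition L1norm {R : realType} (f : R -> \bar R) : R :=
  fine ('N[@lebesgue_measure R]_1[f])%E.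

Definition convolution {R : realType} (f h : R -> \bar R) (x : R) : \bar R :=
  (\int[@lebesgue_measure R]_y (f (x - y)%R * h y))%E.

(* The n-fold convolution power for 1 <= n; the value at n = 0 is junk. *)
Definition convpow {R : realType} (f : R -> \bar R) (n : nat) : R -> \bar R :=
  iter n.-1 (convolution f) f.

Definition cpoisson {R : realType} (f : R -> \bar R) (lam x : R) : \bar R :=
  ((expR (- lam * L1norm f))%:E *
   \sum_(1 <= n <oo) ((lam ^+ n)%:E * convpow f n x / (n`!%:R)%:E))%E.

Definition Gamma {R : realType} (a : R) : R :=
  Rintegral (@lebesgue_measure R) `]0, +oo[
    (fun t => t `^ (a - 1) * expR (- t)).

(* 1 / Gamma(a) for a >= 0, with 1 / Gamma(0) = 0. *)
Definition rGamma {R : realType} (a : R) : R :=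
  if a == 0 then 0 else (Gamma a)^-1.

Definition wright {R : realType} (rho beta t : R) : R :=
  limn (series (fun n => t ^+ n * rGamma (rho * n%:R + beta) / n`!%:R)).

Definition growth_consts {R : realType} (f : R -> \bar R) (C1 C2 : R) : Prop :=
  [/\ 1 <= C1, 1 <= C2,
      forall x y : R, 1 <= `|x| -> `|x| <= `|y| -> `|y| <= `|x| + 1 ->
        (f x <= C1%:E * f y)%E
    & forall x : R, `|x| <= 1 -> (f x <= C2%:E * f (2 * x)%R)%E].

(* The filter |x| -> +oo, in both directions at once. *)
Definition norm_pinfty (R : realType) : set_system R :=
  filter_from [set: R] (fun A => [set x | A < `|x|]).
Arguments norm_pinfty R : clear implicits.

#[global] Instance norm_pinfty_filter (R : realType) :
  ProperFilter (norm_pinfty R).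
Proof.
apply: filter_from_proper => [|A _].
  apply: filter_from_filter; first by exists 0.
  by move=> A B _ _; exists (Num.max A B) => // x /=; rewrite gt_max => /andP.
exists (`|A| + 1) => /=.
rewrite ger0_norm ?addr_ge0//.
by rewrite (le_lt_trans (ler_norm A))// ltrDl.
Qed.

(* Main.v *)
Require Import Defs.
From HB Require Import structures.
From mathcomp Require Import all_boot all_order all_algebra.
From mathcomp Require Import all_classical all_reals all_analysis.
From mathcomp Require Import measurable_realfun.
From mathcomp Require Import ring lra.

(** Write [a = 1 - g], [M] for the [L^1] norm of the profile [f], and [h] for
    the restriction of [f] to the positive half-line, the unnormalised Gamma
    density [e^(-mx) x^(a-1)]. By the Beta integral ([convolution_gdens]), the
    [k]-fold convolution power of [h] is
    [H_k (x) = Gamma(a)^k / Gamma(ak) e^(-mx) x^(ak-1)], and it is a lower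
    bound of the [k]-fold convolution power of [f], as [f >= h].

    All upper bounds come from one inequality ([convpow_le]): for [x > 0], the
    [n]-fold power of [f] at [x] is at most the sum over [k <= n] of
    [C(n, k) M^(n-k) H_k (x)]. It is proved by induction on [n]. In the
    convolution of [f] with the [n]-fold power [F], the region [0 < y < x]
    turns each [H_k] into [H_(k+1)]; the region [y <= 0] contributes at most
    [M^n h(x)], as [f] decreases away from [0]; and the region [y >= x]
    contributes at most [M F(x)], as [F] is, like [f], even and nonincreasing
    in [|x|]: convolution preserves this property
    ([convolution_radially_nonincreasing]). Pascal's rule adds up the three
    contributions.

    For [|x| >= 1] the terms [k < n] are smaller than the term [k = n] by a
    factor [|x|^(-a)] and [1 / Gamma <= 2], which gives the estimates of the
    convolution powers, with [M] in place of the larger [M_2]. Multiplied by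
    [lam^n / n!] and summed over [n], the binomial sums become the Cauchy
    product of the exponential series of [M lam] with the sum of the
    [lam^k H_k / k!], which is a Wright function ([cpoisson_bounds]).

    The estimate of the Wright function for large arguments
    ([wright_large]) is Laplace's method in elementary form. By Stirling's
    formula the [n]-th term is comparable to [exp (b (n ln (s / n) + n))] with
    [b = 1 + a], and the exponent is concave in [n] with its maximum at
    [n = s]. Its tangents at [s (1 + 1/sqrt s)] and [s / (1 + 1/sqrt s)]
    dominate the terms by geometric sequences of scale [sqrt s + 1], so the sum
    is of order [sqrt s e^(b s)]. Stirling's formula itself, up to constants,
    is obtained by the same device from the Gamma integral. *)

Set Implicit Arguments.
Unset Strict Implicit.
Unset Printing Implicit Defensive.

Import Order.TTheory GRing.Theory Num.Theory.
Import numFieldNormedType.Exports.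

Local Open Scope classical_set_scope.
Local Open Scope ring_scope.

(** * Changes of variable and comparison for Lebesgue integrals on the line *)

Section lebesgue_affine.
Context {R : realType}.
Local Notation mu := (@lebesgue_measure R).
Local Open Scope ereal_scope.

Lemma ge0_integral_opp (F : R -> \bar R) : measurable_fun [set: R] F ->
  (forall x, 0 <= F x) -> \int[mu]_x F (- x)%R = \int[mu]_x F x.
Proof.
move=> mF F0.
pose phi : R -> measurableTypeR R := -%R.
have mphi : measurable_fun setT phi by exact: oppr_measurable.
rewrite -[RHS]/(\int[mu]_(x in setT : set (measurableTypeR R)) F x).
transitivity (\int[pushforward mu phi]_x F x); last first.
  by apply: eq_measure_integral => //= A mA _; exact: lebesgue_measureN.
by rewrite ge0_integral_pushforward.
Qed.

(** Up to the factor [u], the image of the Lebesgue measure under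
    [x |-> u x + c] agrees with the Lebesgue measure on intervals, hence
    everywhere by uniqueness. *)
Lemma ge0_integral_affine (u c : R) (F : R -> \bar R) : (0 < u)%R ->
  measurable_fun [set: R] F -> (forall x, 0 <= F x) ->
  \int[mu]_x F (u * x + c)%R = (u^-1)%:E * \int[mu]_x F x.
Proof.
move=> u0 mF F0.
pose phi : measurableTypeR R -> measurableTypeR R := fun x => (u * x + c)%R.
have mphi : measurable_fun setT phi.
  by apply: measurable_funD => //; exact: measurable_funM.
have u0' : (0 <= u)%R by exact: ltW.
pose nu := mscale (NngNum u0') (pushforward mu phi).
have nuE (A : set (measurableTypeR R)) : measurable A -> mu A = nu mphi A.
  apply: lebesgue_measure_unique => _ [[a b]] _ <-.
  rewrite /nu /mscale/= /pushforward.
  rewrite [X in _ = _ * mu X](_ : _ =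
      `]((a - c) / u)%R, ((b - c) / u)%R]%classic); last first.
    apply/seteqP; split => x /=; rewrite !in_itv/= /phi.
      by rewrite ltr_pdivrMr// ler_pdivlMr// ltrBlDr lerBrDr mulrC.
    by rewrite ltr_pdivrMr// ler_pdivlMr// ltrBlDr lerBrDr mulrC.
  rewrite !lebesgue_measure_itv/= !lte_fin ltr_pM2r ?invr_gt0// ltrD2r.
  case: ifPn => ab; last by rewrite mule0.
  by rewrite -!EFinB -EFinM; congr EFin; field; rewrite gt_eqF.
have -> : \int[mu]_x F (u * x + c)%R = \int[pushforward mu phi]_x F x.
  by rewrite ge0_integral_pushforward.
have -> : \int[mu]_x F x = \int[nu mphi]_x F x.
  by apply: eq_measure_integral => //= A mA _; exact: nuE.
rewrite ge0_integral_mscale//= muleA -EFinM mulVf ?gt_eqF//.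
by rewrite mul1e.
Qed.

Lemma ge0_integral_shift (c : R) (F : R -> \bar R) :
  measurable_fun [set: R] F -> (forall x, 0 <= F x) ->
  \int[mu]_x F (x + c)%R = \int[mu]_x F x.
Proof.
move=> mF F0; rewrite -[RHS]mul1e -[X in _ = X%:E * _]invr1.
rewrite -(ge0_integral_affine c ltr01)//.
by apply: eq_integral => x _; rewrite mul1r.
Qed.

Lemma ge0_integral_reflect (c : R) (F : R -> \bar R) :
  measurable_fun [set: R] F -> (forall x, 0 <= F x) ->
  \int[mu]_x F (c - x)%R = \int[mu]_x F x.
Proof.
move=> mF F0.
rewrite -(ge0_integral_shift c mF F0).
rewrite -(ge0_integral_opp (F := fun x => F (x + c)%R))//.
  by apply: eq_integral => x _; rewrite addrC.
by apply: measurableT_comp => //; exact: measurable_funD.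
Qed.

Lemma integralT_ge0Zl (k : R) (F : R -> \bar R) : (0 <= k)%R ->
  measurable_fun [set: R] F -> (forall x, 0 <= F x) ->
  \int[mu]_x (k%:E * F x) = k%:E * \int[mu]_x F x.
Proof. by move=> k0 mF F0; rewrite ge0_integralZl// lee_fin. Qed.

Lemma integralT_ge0D (F G : R -> \bar R) :
  measurable_fun [set: R] F -> measurable_fun [set: R] G ->
  (forall x, 0 <= F x) -> (forall x, 0 <= G x) ->
  \int[mu]_x (F x + G x) = \int[mu]_x F x + \int[mu]_x G x.
Proof. by move=> mF mG F0 G0; rewrite ge0_integralD. Qed.

Lemma integralT_ge0_le (F G : R -> \bar R) :
  measurable_fun [set: R] F -> measurable_fun [set: R] G ->
  (forall x, 0 <= F x) -> (forall x, F x <= G x) ->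
  \int[mu]_x F x <= \int[mu]_x G x.
Proof.
by move=> mF mG F0 FG; apply: ge0_le_integral => //.
Qed.

(** Comparison off the origin, the one point where the profile can be
    infinite. *)
Lemma integralT_ge0_le_off0 (F G : R -> \bar R) :
  measurable_fun [set: R] F -> measurable_fun [set: R] G ->
  (forall x, 0 <= F x) -> (forall x, x != 0%R -> F x <= G x) ->
  \int[mu]_x F x <= \int[mu]_x G x.
Proof.
move=> mF mG F0 FG.
have m0 : measurable ([set: R] `\ 0%R) by exact: measurableD.
rewrite -(integral_setD1 m0 (measurable_funTS mF)).
rewrite -(integral_setD1 m0 (measurable_funTS mG)).
apply: ge0_le_integral => //.
- exact: measurable_funTS.
- exact: measurable_funTS.
- by move=> x [_ /= /eqP]; exact: FG.
Qed.

End lebesgue_affine.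

(** * Convolution of nonnegative functions *)

Lemma le_norm_bounds {R : realDomainType} (a b : R) :
  a <= `|b| -> - a <= `|b| -> `|a| <= `|b|.
Proof. by move=> ? ?; rewrite ler_norml lerNl; apply/andP. Qed.

(** If [0] and [w] lie on the same side of [c / 2], then reflecting [w] in
    [c / 2] moves it away from [0]. *)
Lemma norm_reflect_le {R : realDomainType} (c w : R) :
  0 <= c -> w + w <= c -> `|w| <= `|c - w|.
Proof.
by move=> *; apply: le_norm_bounds; apply: le_trans (ler_norm _); lra.
Qed.

Section convolution_theory.
Context {R : realType}.
Local Notation mu := (@lebesgue_measure R).
Local Open Scope ereal_scope.
Implicit Types f h : R -> \bar R.

Lemma measurable_convolution_integrand f h :
  measurable_fun [set: R] f -> measurable_fun [set: R] h ->
  measurable_fun [set: R * R] (fun p : R * R => f (p.1 - p.2)%R * h p.2).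
Proof.
move=> mf mh; apply: emeasurable_funM.
  by apply: measurableT_comp => //; exact: measurable_funB.
exact: measurableT_comp.
Qed.

Lemma measurable_convolution_section f h x :
  measurable_fun [set: R] f -> measurable_fun [set: R] h ->
  measurable_fun [set: R] (fun y => f (x - y)%R * h y).
Proof.
move=> mf mh; apply: emeasurable_funM => //.
by apply: measurableT_comp => //; exact: measurable_funB.
Qed.

Lemma le_convolution f1 f2 h1 h2 x :
  measurable_fun [set: R] f1 -> measurable_fun [set: R] f2 ->
  measurable_fun [set: R] h1 -> measurable_fun [set: R] h2 ->
  (forall x, 0 <= f1 x) -> (forall x, 0 <= h1 x) ->
  (forall x, f1 x <= f2 x) -> (forall x, h1 x <= h2 x) ->
  convolution f1 h1 x <= convolution f2 h2 x.
Proof.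
move=> mf1 mf2 mh1 mh2 f0 h0 f12 h12; apply: integralT_ge0_le.
- exact: measurable_convolution_section.
- exact: measurable_convolution_section.
- by move=> y; exact: mule_ge0.
- by move=> y; exact: lee_pmul.
Qed.

Lemma measurable_convolution f h :
  measurable_fun [set: R] f -> measurable_fun [set: R] h ->
  (forall x, 0 <= f x) -> (forall x, 0 <= h x) ->
  measurable_fun [set: R] (convolution f h).
Proof.
move=> mf mh f0 h0.
apply: (measurable_fun_fubini_tonelli_F (m2 := mu)
  (fun p : R * R => f (p.1 - p.2)%R * h p.2)).
- exact: measurable_convolution_integrand.
- by move=> p; exact: mule_ge0.
Qed.

Lemma convolution_ge0 f h x :
  (forall x, 0 <= f x) -> (forall x, 0 <= h x) -> 0 <= convolution f h x.
Proof. by move=> f0 h0; apply: integral_ge0 => y _; exact: mule_ge0. Qed.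

(** Tonelli, followed by translation invariance in the inner integral. *)
Lemma integral_convolution f h :
  measurable_fun [set: R] f -> measurable_fun [set: R] h ->
  (forall x, 0 <= f x) -> (forall x, 0 <= h x) ->
  \int[mu]_x convolution f h x = \int[mu]_x f x * \int[mu]_x h x.
Proof.
move=> mf mh f0 h0; rewrite /convolution.
transitivity (\int[mu]_y \int[mu]_x (f (x - y)%R * h y)).
  apply: (fubini_tonelli (m1 := mu) (m2 := mu)
    (fun p : R * R => f (p.1 - p.2)%R * h p.2)).
  - exact: measurable_convolution_integrand.
  - by move=> p; exact: mule_ge0.
rewrite -ge0_integralZl//; last exact: integral_ge0.
apply: eq_integral => y _; rewrite ge0_integralZr//.
- by rewrite (ge0_integral_shift (- y) mf).
- by apply: measurableT_comp => //; exact: measurable_funB.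
Qed.

(** Comparing absolute values makes such a function even as well. *)
Definition radially_nonincreasing f :=
  forall x y : R, (`|x| <= `|y|)%R -> f y <= f x.

Lemma radially_nonincreasing_even f x :
  radially_nonincreasing f -> f (- x)%R = f x.
Proof. by move=> uf; apply/le_anti; rewrite !uf ?normrN. Qed.

Lemma lee_double (a b : \bar R) : 0 <= a -> 0 <= b -> a + a <= b + b -> a <= b.
Proof.
case: a => [a||]; case: b => [b||]//= _ _; rewrite ?leey//.
by rewrite -!EFinD !lee_fin -!mulr2n lerMn2r.
Qed.

(** The rearrangement inequality [(u - v) (s - t) >= 0], expanded so that it
    makes sense, and remains true, for infinite values. *)
Lemma rearrangement2 (u v s t : \bar R) : 0 <= v -> v <= u -> 0 <= t -> t <= s ->
  v * s + u * t <= u * s + v * t.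
Proof.
move=> v0 vu t0 ts.
have s0 := le_trans t0 ts; have u0 := le_trans v0 vu.
have [->|tN0] := eqVneq t 0; first by rewrite !mule0 !adde0 lee_wpmul2r.
have [->|vN0] := eqVneq v 0; first by rewrite !mul0e add0e adde0 lee_wpmul2l.
have t_gt0 : 0 < t by rewrite lt0e tN0.
have v_gt0 : 0 < v by rewrite lt0e vN0.
have vt0 : 0 <= v * t by exact: mule_ge0.
have [uy|uy] := eqVneq u +oo.
  rewrite uy (@gt0_mulye _ s) ?(lt_le_trans t_gt0)// addye ?leey//.
  by rewrite gt_eqF// (lt_le_trans _ vt0).
have [sy|sy] := eqVneq s +oo.
  rewrite sy (@gt0_muley _ u) ?(lt_le_trans v_gt0)// addye ?leey//.
  by rewrite gt_eqF// (lt_le_trans _ vt0).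
have fu : u \is a fin_num by rewrite ge0_fin_numE// ltey.
have fs : s \is a fin_num by rewrite ge0_fin_numE// ltey.
have fv : v \is a fin_num by rewrite ge0_fin_numE// (le_lt_trans vu)// ltey.
have ft : t \is a fin_num by rewrite ge0_fin_numE// (le_lt_trans ts)// ltey.
move: vu ts; rewrite -(fineK fu) -(fineK fs) -(fineK fv) -(fineK ft).
by rewrite -!EFinM -!EFinD !lee_fin => vu ts; nra.
Qed.

(** Let [0 <= x <= y], and reflect the line in the midpoint of [x] and [y].
    Since the reflection exchanges [|x - w|] and [|y - w|], averaging each
    convolution integral with its reflection leaves the integrands
    [v s + u t] at [y] and [u s + v t] at [x], where [u], [v] are the values of
    [f] at [x - w], [y - w] and [s], [t] those of [h] at [w] and at its mirror
    image. On either side of the midpoint [u - v] and [s - t] have the same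
    sign, and the integrands compare by [rearrangement2]. *)
Lemma convolution_radially_nonincreasing f h :
  measurable_fun [set: R] f -> measurable_fun [set: R] h ->
  (forall x, 0 <= f x) -> (forall x, 0 <= h x) ->
  radially_nonincreasing f -> radially_nonincreasing h ->
  radially_nonincreasing (convolution f h).
Proof.
move=> mf mh f0 h0 uf uh.
have conv_even x : convolution f h (- x)%R = convolution f h x.
  rewrite /convolution -[LHS](ge0_integral_opp); first last.
  - by move=> y; exact: mule_ge0.
  - apply: emeasurable_funM => //; apply: measurableT_comp => //.
    exact: measurable_funB.
  apply: eq_integral => y _.
  rewrite -(radially_nonincreasing_even _ uf).
  by rewrite -(radially_nonincreasing_even (- y)%R uh) opprK opprD !opprK.
suff dec (x y : R) : (0 <= x)%R -> (x <= y)%R ->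
    convolution f h y <= convolution f h x.
  move=> x y xy.
  have cE z : convolution f h z = convolution f h `|z|%R.
    by have [//|z0] := ger0P z; rewrite conv_even.
  by rewrite (cE x) (cE y) dec.
move=> x0 xy.
have mF z : measurable_fun [set: R] (fun w => f (z - w)%R * h w).
  apply: emeasurable_funM => //; apply: measurableT_comp => //.
  exact: measurable_funB.
have F0 z w : 0 <= f (z - w)%R * h w by exact: mule_ge0.
(* Averaging over the reflection in the midpoint of [x] and [y]. *)
have refl z : convolution f h z + convolution f h z =
    \int[mu]_w (f (z - w)%R * h w + f (z - (x + y - w))%R * h (x + y - w)%R).
  rewrite ge0_integralD//=; first last.
    apply: (measurableT_comp (mF z)); exact: measurable_funB.
    exact: mF.
  congr (_ + _); rewrite -[LHS](ge0_integral_reflect (x + y)%R)//; exact: mF.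
suff : convolution f h y + convolution f h y <=
    convolution f h x + convolution f h x.
  by apply: lee_double; exact: convolution_ge0.
have mFr z : measurable_fun [set: R]
    (fun w => f (z - (x + y - w))%R * h (x + y - w)%R).
  by apply: (measurableT_comp (mF z)); exact: measurable_funB.
rewrite !refl; apply: ge0_le_integral => //=.
- by move=> w _; exact: adde_ge0.
- by apply: emeasurable_funD; [exact: mF|exact: mFr].
- by apply: emeasurable_funD; [exact: mF|exact: mFr].
move=> w _.
have -> : (x - (x + y - w) = - (y - w))%R by ring.
have -> : (y - (x + y - w) = - (x - w))%R by ring.
rewrite !radially_nonincreasing_even//.
have [wc|/ltW cw] := leP (w + w)%R (x + y)%R.
  apply: rearrangement2 => //; [apply: uf|apply: uh].
    have -> : (y - w = (y - x) - (w - x))%R by ring.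
    by rewrite distrC; apply: norm_reflect_le; clear -xy wc; lra.
  by apply: norm_reflect_le; [clear -x0 xy; lra|].
rewrite addeC [leRHS]addeC; apply: rearrangement2 => //; [apply: uf|apply: uh].
  have e : ((y - x) - (y - w) = w - x)%R by ring.
  rewrite [leRHS]distrC -[in leRHS]e.
  by apply: norm_reflect_le; clear -xy cw; lra.
have e : (x + y - (x + y - w) = w)%R by ring.
by rewrite -[in leRHS]e; apply: norm_reflect_le; clear -x0 xy cw; lra.
Qed.

End convolution_theory.

(** * The Gamma integral and Gamma densities *)

Section gamma_density.
Context {R : realType}.
Local Notation mu := (@lebesgue_measure R).

(** The unnormalised Gamma density, extended by zero to the negative half-line
    so that convolutions can be taken over the whole line. *)
Definition gdens (m s x : R) : R :=
  if 0 < x then expR (- m * x) * x `^ (s - 1) else 0.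

Lemma gdens_ge0 m s x : 0 <= gdens m s x.
Proof.
by rewrite /gdens; case: ifP => // _; rewrite mulr_ge0 ?expR_ge0 ?powR_ge0.
Qed.

Lemma measurable_gdens m s : measurable_fun [set: R] (gdens m s).
Proof.
apply: measurable_fun_ifT => //; first exact: measurable_fun_ltr.
apply: measurable_funM; last exact: measurable_powR.
apply: measurableT_comp => //; exact: measurable_funM.
Qed.

Lemma measurable_EFin_gdens m s :
  measurable_fun [set: R] (fun x => (gdens m s x)%:E).
Proof. by apply/measurable_EFinP; exact: measurable_gdens. Qed.

(** The Gamma integral with values in the extended reals: the identities below
    hold before finiteness is known, and are used to prove it. *)
Definition gammae (s : R) : \bar R := (\int[mu]_x (gdens 1 s x)%:E)%E.

Lemma gammae_ge0 s : (0 <= gammae s)%E.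
Proof. by apply: integral_ge0 => x _; rewrite lee_fin gdens_ge0. Qed.

Lemma Gamma_fine s : Gamma s = fine (gammae s).
Proof.
rewrite /Gamma /Rintegral integral_mkcond; congr fine; apply: eq_integral => x _.
rewrite patchE /gdens; case: ifPn => [|].
  by rewrite inE/= in_itv/= andbT => ->; rewrite mulN1r mulrC.
by rewrite notin_setE/= in_itv/= andbT => /negP/negbTE ->.
Qed.

Lemma integral_gdens m s : 0 < m ->
  (\int[mu]_x (gdens m s x)%:E = (m `^ (- s))%:E * gammae s)%E.
Proof.
move=> m0.
have H := ge0_integral_affine 0 m0 (measurable_EFin_gdens 1 s)
  (fun x => gdens_ge0 1 s x).
have -> : (\int[mu]_x (gdens m s x)%:E =
   (m `^ (1 - s))%:E * \int[mu]_x (gdens 1 s (m * x + 0))%:E)%E.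
  rewrite -ge0_integralZl//; last 3 first.
  - by apply/measurable_EFinP; apply: measurableT_comp (measurable_gdens 1 s) _;
      apply: measurable_funD => //; exact: measurable_funM.
  - by move=> x _; rewrite lee_fin gdens_ge0.
  - by rewrite lee_fin powR_ge0.
  apply: eq_integral => x _; rewrite addr0 -EFinM; congr EFin.
  rewrite /gdens pmulr_rgt0//; case: ifPn => x0; last by rewrite mulr0.
  have mm : m `^ (1 - s) * m `^ (s - 1) = 1.
    rewrite -powRD; last by rewrite (gt_eqF m0) implybT.
    by rewrite addrA subrK subrr powRr0.
  rewrite powRM ?(ltW m0) ?(ltW x0)// mulN1r -mulNr.
  by rewrite [RHS]mulrCA [X in _ = _ * X]mulrA mm mul1r.
rewrite H -/(gammae s) muleA -EFinM; congr (_%:E * _)%E.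
rewrite -[m^-1]powR_inv1 ?(ltW m0)// -powRD ?(gt_eqF m0) ?implybT//.
by rewrite addrAC subrr add0r.
Qed.

(** The integrand is the exponential density, up to its value at [0]. *)
Lemma gammae1 : gammae 1 = 1%E.
Proof.
rewrite -(@integral_exponential_pdf R 1)// /gammae.
rewrite -[LHS](integral_setD1 (r := 0)); last 2 first.
- exact: measurableD.
- by apply: measurable_funTS; exact: measurable_EFin_gdens.
rewrite -[RHS](integral_setD1 (r := 0)); last 2 first.
- exact: measurableD.
- apply: measurable_funTS; apply/measurable_EFinP.
  exact: measurable_exponential_pdf.
apply: eq_integral => x; rewrite inE/= => -[_ /eqP x0]; congr EFin.
rewrite /exponential_pdf patchE /gdens subrr powRr0 mulr1 mul1r.
case: ifPn => x1.
  by rewrite mem_set//= in_itv/= andbT ltW.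
rewrite memNset//= in_itv/= andbT; apply/negP.
by rewrite le_eqVlt (negbTE x1) eq_sym (negbTE x0).
Qed.

End gamma_density.

Section gamma_function.
Context {R : realType}.
Local Notation mu := (@lebesgue_measure R).

Lemma powR_cvgy0 (s : R) : 0 < s -> x `^ (- s) @[x --> +oo] --> (0 : R).
Proof.
move=> s0.
have lny : s * ln x @[x --> +oo] --> +oo.
  apply/cvgryPge => A; near=> x.
  have xA : expR (A / s) <= x by near: x; exact: nbhs_pinfty_ge.
  rewrite mulrC -ler_pdivrMr// -(expRK (A / s)).
  by rewrite ler_ln ?posrE ?expR_gt0 ?(lt_le_trans _ xA) ?expR_gt0.
apply: cvg_trans (cvg_comp _ _ lny (@cvgr_expR R)).
apply: near_eq_cvg; near=> x.
have x0 : 0 < x by near: x; exact: nbhs_pinfty_gt.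
by rewrite /= /powR gt_eqF// mulNr.
Unshelve. all: end_near. Qed.

Lemma integral_powR_tail (s : R) : 0 < s ->
  (\int[mu]_(x in `[1%R, +oo[) (x `^ (- s - 1))%:E = (s^-1)%:E)%E.
Proof.
move=> s0.
have dF (x : R) : 0 < x ->
    is_derive x 1 (fun x => - s^-1 * x `^ (- s)) (x `^ (- s - 1)).
  move=> x0; have := is_derive1_powR (- s) x0.
  move=> /(is_deriveZ (- s^-1)); rewrite /GRing.scale/= mulrA mulrNN.
  by rewrite mulVf ?gt_eqF// mul1r.
have cp (p x : R) : 0 < x -> {for x, continuous (@powR R ^~ p)}.
  move=> x0; have [d _] := is_derive1_powR p x0.
  exact/differentiable_continuous/derivable1_diffP.
rewrite (@ge0_continuous_FTC2y _ _ (fun x => - s^-1 * x `^ (- s)) _ 0).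
- by rewrite powR1 mulr1 sub0e -EFinN opprK.
- by move=> x _; exact: powR_ge0.
- apply/continuous_within_itvcyP; split.
    move=> x; rewrite in_itv/= andbT => x1; apply: cp; exact: lt_trans x1.
  apply: cvg_at_right_filter; exact: cp.
- rewrite -[0 in X in _ --> X](mulr0 (- s^-1)); apply: cvgMr.
  exact: powR_cvgy0.
- by move=> x x1; have [] := dF x (lt_trans ltr01 x1).
- by apply: cvg_at_right_filter; apply: cvgMr; exact: cp.
- move=> x; rewrite in_itv/= andbT => x1; rewrite derive1E.
  by have [_ ->] := dF x (lt_trans ltr01 x1).
Qed.

Lemma measurable_gdens2 (s : R) :
  measurable_fun [set: R * R] (fun p : R * R => gdens p.1 s p.2).
Proof.
apply: measurable_fun_ifT => //.
  by apply: measurable_fun_ltr.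
apply: measurable_funM; last exact: measurableT_comp (measurable_powR _) _.
apply: measurableT_comp => //; apply: measurable_funM => //.
exact: measurableT_comp.
Qed.

(** Write [e^(-t)] as the integral of [t e^(-ut)] over [u >= 1] and exchange
    the integrals: the one in [t] becomes [u^(-s-1) Gamma (s + 1)], and
    [u^(-s-1)] has mass [1/s] on [u >= 1]. *)
Lemma gammaeS (s : R) : 0 < s -> gammae s = ((s^-1)%:E * gammae (s + 1))%E.
Proof.
move=> s0.
(* [p.1] is the auxiliary variable [u], [p.2] the variable [t]. *)
pose K (p : R * R) : \bar R :=
  if 1 <= p.1 then (gdens p.1 (s + 1) p.2)%:E else 0%E.
have K0 p : (0 <= K p)%E.
  by rewrite /K; case: ifP => // _; rewrite lee_fin gdens_ge0.
have mK : measurable_fun [set: R * R] K.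
  apply: measurable_fun_ifT => //; first exact: measurable_fun_ler.
  by apply/measurable_EFinP; exact: measurable_gdens2.
transitivity (\int[mu]_t \int[mu]_u K (u, t))%E.
  apply: eq_integral => t _; rewrite /K/=.
  have [t0|t0] := ltP 0 t; last first.
    rewrite /gdens ltNge t0/= integral0_eq// => u _.
    by case: ifP.
  pose c := (t `^ (s - 1) * expR (- t))%:E.
  transitivity (c * \int[mu]_u (exponential_pdf t (u + - 1)%R)%:E)%E.
    rewrite (ge0_integral_shift (-1) (F := fun x => (exponential_pdf t x)%:E)).
    - rewrite integral_exponential_pdf// mule1 /c /gdens t0 mulN1r mulrC//.
    - by apply/measurable_EFinP; exact: measurable_exponential_pdf.
    - by move=> u; rewrite lee_fin exponential_pdf_ge0// ltW.
  rewrite -ge0_integralZl//; last 3 first.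
  - apply/measurable_EFinP.
    apply: measurableT_comp (measurable_exponential_pdf _) _.
    exact: measurable_funD.
  - by move=> u _; rewrite lee_fin exponential_pdf_ge0// ltW.
  - by rewrite lee_fin mulr_ge0 ?powR_ge0 ?expR_ge0.
  apply: eq_integral => u _; rewrite /exponential_pdf patchE.
  rewrite mem_setE in_itv/= andbT subr_ge0.
  case: ifP => u1; last by rewrite mule0.
  rewrite /gdens t0 -EFinM; congr EFin; rewrite addrK.
  rewrite mulrACA [t `^ _ * t]mulrC mulr_powRB1 ?ltW// -expRD mulrC.
  by congr (expR _ * _); ring.
rewrite (fubini_tonelli (m1 := mu) (m2 := mu) (fun p => K (p.2, p.1)));
  last 2 first.
- by apply: (measurableT_comp mK); exact: measurable_swap.
- by move=> p; exact: K0.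
transitivity (\int[mu]_u
    (((fun u => (u `^ (- s - 1))%:E) \_ `[1%R, +oo[) u * gammae (s + 1)))%E.
  apply: eq_integral => u _; rewrite /K/= patchE mem_setE in_itv/= andbT.
  case: ifP => u1; last by rewrite mul0e integral0.
  by rewrite integral_gdens ?(lt_le_trans _ u1)// opprD.
rewrite ge0_integralZr// ?gammae_ge0//.
- by rewrite -integral_mkcond integral_powR_tail.
- apply/measurable_restrict => //; apply: measurable_funTS.
  by apply/measurable_EFinP; exact: measurable_powR.
- by move=> u _; rewrite patchE; case: ifP => // _; rewrite lee_fin powR_ge0.
Qed.

End gamma_function.

(** * Saddle point estimates *)

Section saddle_point.
Context {R : realType}.
Local Notation mu := (@lebesgue_measure R).

Lemma ln_tangent (w t : R) : 0 < w -> 0 < t -> ln t <= ln w + t / w - 1.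
Proof.
move=> w0 t0.
have tw : 0 < t / w by rewrite divr_gt0.
have := @le_ln1Dx R (t / w - 1); rewrite addrCA subrr addr0.
rewrite ltrBrDl subrr tw => /(_ isT).
rewrite ln_div ?posrE//; lra.
Qed.

Lemma ln1Vr_bounds (r : R) : 0 < r ->
  (r + 1)^-1 <= ln (1 + r^-1) /\ ln (1 + r^-1) <= r^-1.
Proof.
move=> r0; have r1 : 0 < r + 1 by lra.
have rV : 0 < r^-1 by rewrite invr_gt0.
split; last by apply: le_ln1Dx; lra.
have -> : 1 + r^-1 = (1 - (r + 1)^-1)^-1.
  by field; rewrite ?gt_eqF//=; lra.
have rV1 : (r + 1)^-1 < 1 by rewrite invf_lt1//; lra.
rewrite lnV ?posrE ?subr_gt0// lerNr.
by apply: le_ln1Dx; lra.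
Qed.

(** This difference is the error made in the two saddle point bounds below. *)
Lemma saddle_excess_le1 (r : R) : 0 < r -> r - r ^+ 2 / (r + 1) <= 1.
Proof.
move=> r0; have r1 : 0 < r + 1 by lra.
have -> : r - r ^+ 2 / (r + 1) = 1 - (r + 1)^-1 by field; rewrite gt_eqF.
by rewrite lerBlDr lerDl invr_ge0 ltW.
Qed.

(** With [z = r^2], the exponent [z ln t - t] of the integrand of
    [Gamma (z + 1)] is concave in [t] with its maximum at [z]. Bounding [ln] by
    its tangents at [z (1 + 1/r)] on the right of [z] and at [z / (1 + 1/r)] on
    the left, that is about one standard deviation away from the maximum,
    makes the integrand decay exponentially at scale [r + 1], at the price of
    a factor [e]. *)
Lemma saddle_gamma (r t : R) : 0 < r -> 0 < t ->
  r ^+ 2 * ln t - t <=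
  r ^+ 2 * ln (r ^+ 2) - r ^+ 2 + 1 - `|t - r ^+ 2| / (r + 1).
Proof.
move=> r0 t0; have r1 : 0 < r + 1 by lra.
have [L1 L2] := ln1Vr_bounds r0.
have rr0 : 0 < r ^+ 2 by rewrite exprn_gt0.
have rV : 0 < 1 + r^-1 by rewrite addr_gt0 ?invr_gt0.
have S := saddle_excess_le1 r0.
have [tr|tr] := leP (r ^+ 2) t.
- have w0 : 0 < r ^+ 2 * (1 + r^-1) by rewrite mulr_gt0.
  have := ln_tangent w0 t0; rewrite lnM ?posrE// => /(ler_wpM2l (ltW rr0)).
  have -> : r ^+ 2 *
      (ln (r ^+ 2) + ln (1 + r^-1) + t / (r ^+ 2 * (1 + r^-1)) - 1) =
     r ^+ 2 * ln (r ^+ 2) + r ^+ 2 * ln (1 + r^-1) + t - t / (r + 1) - r ^+ 2.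
    by field; rewrite !gt_eqF//=; nra.
  move/(ler_wpM2l (ltW rr0)): L2.
  have -> : r ^+ 2 / r = r by field; rewrite gt_eqF.
  rewrite ger0_norm ?subr_ge0// mulrBl; lra.
- have w0 : 0 < r ^+ 2 / (1 + r^-1) by rewrite divr_gt0.
  have := ln_tangent w0 t0; rewrite ln_div ?posrE// => /(ler_wpM2l (ltW rr0)).
  have -> : r ^+ 2 *
      (ln (r ^+ 2) - ln (1 + r^-1) + t / (r ^+ 2 / (1 + r^-1)) - 1) =
     r ^+ 2 * ln (r ^+ 2) - r ^+ 2 * ln (1 + r^-1) + t + t / r - r ^+ 2.
    by field; rewrite !gt_eqF//=; nra.
  move/(ler_wpM2l (ltW rr0)): L1.
  rewrite ltr0_norm ?subr_lt0// opprB.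
  have : (r ^+ 2 - t) / (r + 1) <= (r ^+ 2 - t) / r.
    by rewrite ler_pM2l ?subr_gt0// lef_pV2 ?posrE//; lra.
  have -> : (r ^+ 2 - t) / r = r - t / r by field; rewrite gt_eqF.
  lra.
Qed.

(** The discrete counterpart: with [s = r^2], the exponent [y ln (s / y) + y]
    is concave in [y] with maximum [s] at [y = s], and it lies below its
    tangents at [s (1 + 1/r)] and at [s / (1 + 1/r)]. *)
Lemma saddle_sum (r y : R) : 0 < r -> 0 < y ->
  y * ln (r ^+ 2 / y) + y <= r ^+ 2 + 1 - `|y - r ^+ 2| / (r + 1).
Proof.
move=> r0 y0; have r1 : 0 < r + 1 by lra.
have [L1 L2] := ln1Vr_bounds r0.
have rr0 : 0 < r ^+ 2 by rewrite exprn_gt0.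
have rV : 0 < 1 + r^-1 by rewrite addr_gt0 ?invr_gt0.
have S := saddle_excess_le1 r0.
rewrite ln_div ?posrE//.
have [tr|tr] := leP (r ^+ 2) y.
- have w0 : 0 < r ^+ 2 * (1 + r^-1) by rewrite mulr_gt0.
  have := ln_tangent y0 w0; rewrite lnM ?posrE// => /(ler_wpM2l (ltW y0)).
  have -> : y * (ln y + r ^+ 2 * (1 + r^-1) / y - 1) =
     y * ln y + (r ^+ 2 + r) - y.
    by field; rewrite !gt_eqF.
  move/(ler_wpM2l (ltW y0)): L1.
  rewrite ger0_norm ?subr_ge0// mulrBl !mulrDr; lra.
- have w0 : 0 < r ^+ 2 / (1 + r^-1) by rewrite divr_gt0.
  have := ln_tangent y0 w0; rewrite ln_div ?posrE// => /(ler_wpM2l (ltW y0)).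
  have -> : y * (ln y + r ^+ 2 / (1 + r^-1) / y - 1) =
     y * ln y + (r ^+ 2 - r ^+ 2 / (r + 1)) - y.
    by field; rewrite !gt_eqF//=; nra.
  move/(ler_wpM2l (ltW y0)): L2.
  rewrite ltr0_norm ?subr_lt0// opprB.
  have : (r ^+ 2 - y) / (r + 1) <= (r ^+ 2 - y) / r.
    by rewrite ler_pM2l ?subr_gt0// lef_pV2 ?posrE//; lra.
  have -> : (r ^+ 2 - y) / r = r - y / r by field; rewrite gt_eqF.
  rewrite !mulrDr; lra.
Qed.

(** Within one standard deviation of the maximum, the exponent drops by at
    most [1]. *)
Lemma saddle_gamma_lower (r t : R) : 0 < r -> r ^+ 2 <= t -> t <= r ^+ 2 + r ->
  r ^+ 2 * ln (r ^+ 2) - r ^+ 2 - 1 <= r ^+ 2 * ln t - t.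
Proof.
move=> r0 rt tr.
have rr0 : 0 < r ^+ 2 by rewrite exprn_gt0.
have t0 : 0 < t by lra.
have := ln_tangent t0 rr0 => /(ler_wpM2l (ltW rr0)).
rewrite !mulrDr mulrN1 => H.
suff : r ^+ 2 * (r ^+ 2 / t) + t - 2 * r ^+ 2 <= 1 by lra.
have -> : r ^+ 2 * (r ^+ 2 / t) + t - 2 * r ^+ 2 = (t - r ^+ 2) ^+ 2 / t.
  by field; rewrite gt_eqF.
rewrite ler_pdivrMr// mul1r (le_trans _ rt)// ler_sqr ?nnegrE; lra.
Qed.

Lemma measurable_laplace (c z : R) :
  measurable_fun [set: R] (fun x => (expR (- (`|x - z| / c)))%:E).
Proof.
apply/measurable_EFinP; apply: measurableT_comp => //.
apply: measurableT_comp => //; apply: measurable_funM => //.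
by apply: measurableT_comp => //; exact: measurable_funD.
Qed.

(** Each half of the two-sided exponential is [c] times an exponential
    probability density. *)
Lemma integral_laplace_le (c z : R) : 0 < c ->
  (\int[mu]_x (expR (- (`|x - z| / c)))%:E <= (2 * c)%:E)%E.
Proof.
move=> c0; have cV : 0 < c^-1 by rewrite invr_gt0.
pose P (x : R) : \bar R := (exponential_pdf c^-1 x)%:E.
have mP : measurable_fun [set: R] P.
  by apply/measurable_EFinP; exact: measurable_exponential_pdf.
have P0 x : (0 <= P x)%E by rewrite lee_fin exponential_pdf_ge0// ltW.
have mP1 : measurable_fun [set: R] (fun x => P (x - z)).
  by apply: (measurableT_comp mP); exact: measurable_funD.
have mP2 : measurable_fun [set: R] (fun x => P (z - x)).
  by apply: (measurableT_comp mP); exact: measurable_funB.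
apply: (@le_trans _ _ (\int[mu]_x (c%:E * (P (x - z)%R + P (z - x)%R)))%E).
  apply: ge0_le_integral => //.
  - exact: measurable_laplace.
  - by apply: emeasurable_funM => //; exact: emeasurable_funD.
  move=> x _; rewrite /P -EFinD -EFinM lee_fin /exponential_pdf.
  rewrite !patchE !mem_setE !in_itv/= !andbT.
  have [xz|xz] := leP 0 (x - z).
    rewrite mulrDr -[leLHS]addr0 lerD//.
      by rewrite mulrA divff ?gt_eqF// mul1r ger0_norm// mulNr mulrC.
    by case: ifPn => // _; rewrite ?mulr0// !mulr_ge0 ?expR_ge0// ltW.
  rewrite add0r ifT ?subr_ge0; last by move: xz; rewrite subr_lt0 => /ltW.
  rewrite mulrA divff ?gt_eqF// mul1r ltr0_norm//.
  by rewrite ler_expR le_eqVlt; apply/orP; left; apply/eqP; ring.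
rewrite ge0_integralZl//; last 3 first.
- exact: emeasurable_funD.
- by move=> x _; rewrite adde_ge0.
- by rewrite lee_fin ltW.
rewrite ge0_integralD//.
rewrite (ge0_integral_shift (- z) mP P0) (ge0_integral_reflect z mP P0).
by rewrite integral_exponential_pdf// -EFinD -EFinM mulrC.
Qed.

Lemma gammae_le (r : R) : 0 < r -> (gammae (r ^+ 2 + 1) <=
  (expR (r ^+ 2 * ln (r ^+ 2) - r ^+ 2 + 1) * (2 * (r + 1)))%:E)%E.
Proof.
move=> r0; have r1 : 0 < r + 1 by lra.
set c := expR _.
have mL := measurable_laplace (r + 1) (r ^+ 2).
apply: (@le_trans _ _
    (\int[mu]_x (c%:E * (expR (- (`|x - r ^+ 2| / (r + 1))))%:E))%E).
  apply: ge0_le_integral => //.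
  - by move=> x _; rewrite lee_fin gdens_ge0.
  - exact: measurable_EFin_gdens.
  - exact: emeasurable_funM.
  move=> x _; rewrite -EFinM lee_fin /gdens; case: ifPn => x0; last first.
    by rewrite mulr_ge0 ?expR_ge0.
  rewrite addrK /powR gt_eqF// -!expRD ler_expR.
  have := saddle_gamma r0 x0; lra.
rewrite ge0_integralZl//; last by rewrite lee_fin expR_ge0.
by rewrite EFinM lee_wpmul2l ?lee_fin ?expR_ge0//; exact: integral_laplace_le.
Qed.

Lemma gammae_ge (r : R) : 0 < r ->
  ((expR (r ^+ 2 * ln (r ^+ 2) - r ^+ 2 - 1) * r)%:E <= gammae (r ^+ 2 + 1))%E.
Proof.
move=> r0; have rr0 : 0 < r ^+ 2 by rewrite exprn_gt0.
set c := expR _.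
apply: (@le_trans _ _ (\int[mu]_(x in `[(r ^+ 2)%R, (r ^+ 2 + r)%R])
    (gdens 1 (r ^+ 2 + 1) x)%:E)%E); last first.
  apply: ge0_subset_integral => //.
  - exact: measurable_EFin_gdens.
  - by move=> x _; rewrite lee_fin gdens_ge0.
have -> : (c * r)%:E =
    (\int[mu]_(x in `[(r ^+ 2)%R, (r ^+ 2 + r)%R]) (cst c%:E) x)%E.
  rewrite integral_cst//= lebesgue_measure_itv/= lte_fin ltrDl r0 -EFinB.
  by rewrite addrAC subrr add0r.
apply: ge0_le_integral => //.
- by move=> x _; rewrite lee_fin expR_ge0.
- by apply: measurable_funTS; exact: measurable_EFin_gdens.
move=> x; rewrite /= in_itv/= => /andP[x1 x2].
have x0 : 0 < x := lt_le_trans rr0 x1.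
rewrite lee_fin /gdens x0 addrK /powR gt_eqF// -expRD ler_expR.
have := saddle_gamma_lower r0 x1 x2; lra.
Qed.

End saddle_point.

(** * The Gamma function and the Beta integral *)

Section gamma_values.
Context {R : realType}.
Local Notation mu := (@lebesgue_measure R).

(** The saddle point bound controls [Gamma (s + 1)] for all [s > 0], and the
    functional equation brings it down to [Gamma s]. *)
Lemma gammae_fin_num (s : R) : 0 < s -> gammae s \is a fin_num.
Proof.
move=> s0; rewrite gammaeS// ge0_fin_numE; last first.
  by rewrite mule_ge0 ?gammae_ge0// lee_fin invr_ge0 ltW.
apply: lte_mul_pinfty => //; first by rewrite lee_fin invr_ge0 ltW.
have r0 : 0 < Num.sqrt s by rewrite sqrtr_gt0.
have := gammae_le r0; rewrite sqr_sqrtr; last exact: ltW.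
by move/le_lt_trans; apply; rewrite ltry.
Qed.

Lemma gammaeE (s : R) : 0 < s -> gammae s = (Gamma s)%:E.
Proof. by move=> s0; rewrite Gamma_fine fineK// gammae_fin_num. Qed.

Lemma Gamma1 : Gamma 1 = 1 :> R.
Proof. by rewrite Gamma_fine gammae1. Qed.

Lemma GammaS (s : R) : 0 < s -> Gamma (s + 1) = s * Gamma s.
Proof.
move=> s0; have := gammaeS s0; rewrite !gammaeE//; last by lra.
by rewrite -EFinM => -[->]; rewrite mulrA divff ?gt_eqF// mul1r.
Qed.

(** Stirling's formula up to constants, with [z = r^2], valid for every
    [z > 0]. *)
Lemma Gamma_stirling (r : R) : 0 < r ->
  expR (r ^+ 2 * ln (r ^+ 2) - r ^+ 2 - 1) * r <= Gamma (r ^+ 2 + 1) /\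
  Gamma (r ^+ 2 + 1) <= expR (r ^+ 2 * ln (r ^+ 2) - r ^+ 2 + 1) * (2 * (r + 1)).
Proof.
move=> r0; have rr0 : 0 < r ^+ 2 by rewrite exprn_gt0.
by have := gammae_le r0; have := gammae_ge r0; rewrite gammaeE ?lee_fin//; lra.
Qed.

Lemma Gamma_gt0 (s : R) : 0 < s -> 0 < Gamma s.
Proof.
move=> s0; have r0 : 0 < Num.sqrt s by rewrite sqrtr_gt0.
have [+ _] := Gamma_stirling r0; rewrite sqr_sqrtr; last exact: ltW.
rewrite GammaS// => H.
rewrite -(pmulr_rgt0 _ s0) (lt_le_trans _ H)// mulr_gt0//; exact: expR_gt0.
Qed.

Lemma Gamma_fact n : Gamma (n.+1%:R) = n`!%:R :> R.
Proof.
elim: n => [|n IH]; first by rewrite Gamma1.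
by rewrite -natr1 GammaS// IH factS natrM.
Qed.

(** For [1 <= s <= 2] one has [t^(s-1) >= min (1, t) >= t - t^2/4], and the
    last expression integrates to [Gamma 2 - Gamma 3 / 4 = 1/2] against
    [e^(-t)]. The functional equation carries the bound to all [s > 0]: it
    divides by [s < 1] below [1] and multiplies by factors at least [1]
    above [2]. *)
Lemma Gamma_ge_half (s : R) : 0 < s -> 2^-1 <= Gamma s.
Proof.
have base (z : R) : 1 <= z -> z <= 2 -> 2^-1 <= Gamma z.
  move=> z1 z2; have z0 : 0 < z by lra.
  have le3 : (gammae 2 <= gammae z + (4^-1)%:E * gammae 3 :> \bar R)%E.
    rewrite -ge0_integralZl//; last 2 first.
    - exact: measurable_EFin_gdens.
    - by move=> x _; rewrite lee_fin gdens_ge0.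
    rewrite -ge0_integralD//; last 4 first.
    - by move=> x _; rewrite lee_fin gdens_ge0.
    - exact: measurable_EFin_gdens.
    - by move=> x _; rewrite -EFinM lee_fin mulr_ge0 ?gdens_ge0.
    - by apply: emeasurable_funM => //; exact: measurable_EFin_gdens.
    apply: ge0_le_integral => //.
    - by move=> x _; rewrite lee_fin gdens_ge0.
    - exact: measurable_EFin_gdens.
    - apply: emeasurable_funD; first exact: measurable_EFin_gdens.
      by apply: emeasurable_funM => //; exact: measurable_EFin_gdens.
    move=> t _; rewrite -EFinM -EFinD lee_fin /gdens; case: ifPn => t0; last lra.
    rewrite mulrCA -mulrDr ler_wpM2l ?expR_ge0//.
    have -> : 2 - 1 = 1 :> R by lra.
    have -> : 3 - 1 = 2%:R :> R by lra.
    rewrite (powRr1 (ltW t0)) (powR_mulrn _ (ltW t0)).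
    have [t1|t1] := leP 1 t.
      have : 1 <= t `^ (z - 1) by rewrite -[leLHS](powRr0 t) ler_powR//; lra.
      have := sqr_ge0 (t / 2 - 1); rewrite !expr2; lra.
    have : t <= t `^ (z - 1).
      rewrite -[leLHS](powRr1 (ltW t0)); apply: ger_powR; last lra.
      by rewrite t0 (ltW t1).
    have := sqr_ge0 t; lra.
  have G2 : Gamma 2 = 1 :> R by rewrite (@Gamma_fact 1).
  have G3 : Gamma 3 = 2 :> R by rewrite (@Gamma_fact 2).
  move: le3; rewrite (gammaeE z0) (gammaeE (s := 2))// (gammaeE (s := 3))//.
  rewrite G2 G3 -EFinM -EFinD lee_fin; move: (Gamma z) => w; lra.
move=> s0; have [s1|s1] := leP 1 s; last first.
  have : 2^-1 <= Gamma (s + 1) by apply: base; lra.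
  rewrite GammaS// => /le_trans; apply.
  by rewrite ger_pMl ?Gamma_gt0// ltW.
have [n sn] : exists n, s <= n.+2%:R.
  exists (Num.truncn s); apply: ltW.
  by rewrite (lt_le_trans (truncnS_gt _))// ler_nat.
elim: n s s0 s1 sn => [|n IH] s s0 s1 sn; first exact: base.
have [s2|s2] := leP s 2; first exact: base.
have -> : s = (s - 1) + 1 by ring.
rewrite GammaS; last by lra.
have : 2^-1 <= Gamma (s - 1).
  by apply: IH; [lra|lra|]; rewrite lerBlDr natr1.
by move/le_trans; apply; rewrite ler_peMl ?ltW ?Gamma_gt0//; lra.
Qed.

(** Scaling by [x] shows that the convolution is a constant [B] (the Beta
    integral) times the density on the right. Comparing total masses for
    [m = 1] gives the value of [B]. *)
Lemma convolution_gdens (m p q x : R) : 0 < p -> 0 < q ->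
  convolution (fun y => (gdens m p y)%:E) (fun y => (gdens m q y)%:E) x =
  (Gamma p * Gamma q / Gamma (p + q) * gdens m (p + q) x)%:E.
Proof.
move=> p0 q0.
pose B : \bar R := (\int[mu]_u (gdens 0 p (1 - u) * gdens 0 q u)%:E)%E.
have mB n r s z :
    measurable_fun [set: R] (fun u => (gdens n r (z - u) * gdens n s u)%:E).
  apply/measurable_EFinP; apply: measurable_funM; last exact: measurable_gdens.
  by apply: (measurableT_comp (measurable_gdens n r)); exact: measurable_funB.
have B0 : (0 <= B)%E.
  by apply: integral_ge0 => u _; rewrite lee_fin mulr_ge0 ?gdens_ge0.
have convE n z :
    convolution (fun y => (gdens n p y)%:E) (fun y => (gdens n q y)%:E) z =
    (B * (gdens n (p + q) z)%:E)%E.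
  rewrite /convolution; under eq_integral do rewrite -EFinM.
  have [z0|z0] := ltP 0 z; last first.
    have -> : gdens n (p + q) z = 0 by rewrite /gdens ltNge z0.
    rewrite mule0 integral0_eq// => y _; congr EFin.
    rewrite /gdens; case: ifPn => zy; last by rewrite mul0r.
    by rewrite ifF ?mulr0//; apply/negbTE; rewrite -leNgt; lra.
  have := ge0_integral_affine 0 z0 (mB n p q z)
    (fun u => mulr_ge0 (gdens_ge0 n p (z - u)) (gdens_ge0 n q u)).
  move=> /(congr1 (fun w => z%:E * w)%E).
  rewrite muleA -EFinM divff ?gt_eqF// mul1e => <-.
  pose F1 u := (gdens n p (z - (z * u + 0)) * gdens n q (z * u + 0))%:E.
  rewrite -[LHS](@integralT_ge0Zl _ z F1); last 3 first.
  - exact: ltW.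
  - rewrite /F1; apply: (measurableT_comp (mB n p q z)).
    by apply: measurable_funD => //; apply: measurable_funM.
  - by move=> u; rewrite lee_fin mulr_ge0 ?gdens_ge0.
  rewrite muleC -(@integralT_ge0Zl _ (gdens n (p + q) z)
    (fun u => (gdens 0 p (1 - u) * gdens 0 q u)%:E)); last 3 first.
  - exact: gdens_ge0.
  - exact: mB.
  - by move=> u; rewrite lee_fin mulr_ge0 ?gdens_ge0.
  rewrite /F1.
  apply: eq_integral => u _; rewrite -!EFinM; congr EFin; rewrite addr0.
  have -> : z - z * u = z * (1 - u) by ring.
  rewrite /gdens z0 !pmulr_rgt0//.
  case: ifPn => u1; last by rewrite !(mul0r, mulr0).
  case: ifPn => u0; last by rewrite !mulr0.
  rewrite !powRM ?ltW// -[X in X * _ = _](powRr1 (ltW z0)).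
  have -> : p + q - 1 = 1 + (p - 1) + (q - 1) by ring.
  rewrite !powRD ?(gt_eqF z0) ?(gt_eqF u0) ?(gt_eqF u1) ?implybT//.
  have -> : - n * z = - n * (z * (1 - u)) + - n * (z * u) by ring.
  by rewrite expRD oppr0 !mul0r expR0; ring.
have : (gammae p * gammae q = B * gammae (p + q))%E.
  rewrite -integral_convolution; last 4 first.
  - exact: measurable_EFin_gdens.
  - exact: measurable_EFin_gdens.
  - by move=> ?; rewrite lee_fin gdens_ge0.
  - by move=> ?; rewrite lee_fin gdens_ge0.
  transitivity (\int[mu]_t (B * (gdens 1 (p + q) t)%:E))%E.
    by apply: eq_integral => t _; exact: convE.
  apply: ge0_integralZl => //; first exact: measurable_EFin_gdens.
  by move=> t _; rewrite lee_fin gdens_ge0.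
have pq : 0 < p + q by lra.
rewrite convE !gammaeE// => BE.
have Bf : B \is a fin_num.
  rewrite ge0_fin_numE// ltey; apply/eqP => By; move: BE.
  by rewrite By gt0_mulye ?lte_fin ?Gamma_gt0.
move: BE; rewrite -(fineK Bf) -!EFinM => -[->].
by rewrite mulfK ?gt_eqF ?Gamma_gt0.
Qed.

End gamma_values.

(** * Convolution powers of the profile *)

Section binomial_transform.
Context {R : comNzRingType}.

Definition binomial_transform (c : R) (u : nat -> R) (n : nat) : R :=
  \sum_(k < n.+1) 'C(n, k)%:R * c ^+ (n - k) * u k.

(** Pascal's rule. *)
Lemma binomial_transformS c u n :
  binomial_transform c u n.+1 =
  c * binomial_transform c u n + binomial_transform c (fun k => u k.+1) n.
Proof.
rewrite /binomial_transform big_ord_recl/= bin0 subn0.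
under eq_bigr do rewrite /bump/= add1n binS subSS natrD mulrDl mulrDl.
rewrite big_split/= addrA; congr (_ + _).
rewrite mulr_sumr [in RHS]big_ord_recl/= bin0 subn0 exprS; congr (_ + _).
  by ring.
rewrite big_ord_recr/= bin_small// mul0r mul0r addr0.
apply: eq_bigr => i _; rewrite /bump/= add1n -(subnSK (ltn_ord i)) exprS.
by ring.
Qed.

End binomial_transform.

Section profile_convolutions.
Context {R : realType}.
Local Notation mu := (@lebesgue_measure R).
Variables (m g : R).
Hypotheses (m_gt0 : 0 < m) (g_ge0 : 0 <= g) (g_lt1 : g < 1).
Local Notation f := (profile m g).
Local Notation a := (1 - g).
Local Notation M := (L1norm f).

Lemma a_gt0 : 0 < a.
Proof. by rewrite subr_gt0. Qed.

Lemma profileE x : x != 0 -> f x = (expR (- m * `|x|) * `|x| `^ (- g))%:E.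
Proof. by move=> x0; rewrite /profile (negbTE x0). Qed.

Lemma profile_ge0 x : (0 <= f x)%E.
Proof. by rewrite /profile; case: ifP. Qed.

Lemma profile_gdens x : 0 < x -> f x = (gdens m a x)%:E.
Proof.
move=> x0; rewrite profileE ?gt_eqF// /gdens x0 gtr0_norm//.
by rewrite addrAC subrr add0r.
Qed.

Lemma gdens_le_profile x : ((gdens m a x)%:E <= f x)%E.
Proof.
have [x0|x0] := ltP 0 x; first by rewrite profile_gdens.
by rewrite /gdens ltNge x0 profile_ge0.
Qed.

Lemma measurable_profile : measurable_fun [set: R] f.
Proof.
apply: measurable_fun_ifT => //.
  by apply: (measurable_and (measurable_fun_eqr _ _)).
apply/measurable_EFinP; apply: measurable_funM.
  apply: measurableT_comp => //; apply: measurable_funM => //.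
exact: (measurableT_comp (measurable_powR _)).
Qed.

Lemma profile_radial : radially_nonincreasing f.
Proof.
move=> x y xy; have [x0|x0] := eqVneq x 0.
  rewrite x0; have [g0|g0] := ltP 0 g; first by rewrite {2}/profile eqxx g0 leey.
  rewrite /profile ltNge g0 !andbF lee_fin normr0 mulr0 expR0 mul1r.
  have -> : g = 0 by apply/le_anti; rewrite g0 g_ge0.
  by rewrite oppr0 !powRr0 mulr1 -expR0 ler_expR mulNr oppr_le0 mulr_ge0// ltW.
have x_gt0 : 0 < `|x| by rewrite normr_gt0.
have y_gt0 : 0 < `|y| := lt_le_trans x_gt0 xy.
rewrite !profileE -?normr_gt0// lee_fin ler_pM ?expR_ge0 ?powR_ge0//.
  by rewrite ler_expR !mulNr lerN2 ler_pM2l.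
rewrite !powRN lef_pV2 ?posrE ?powR_gt0//.
by apply: ge0_ler_powR; rewrite ?nnegrE//.
Qed.

(** Off the origin the profile is the sum of a Gamma density and its
    reflection, which makes it integrable. *)
Lemma L1normE : (\int[mu]_x f x = M%:E)%E.
Proof.
rewrite /L1norm Lnorm1.
under [in RHS]eq_integral do rewrite gee0_abs ?profile_ge0//.
rewrite fineK// ge0_fin_numE; last first.
  by apply: integral_ge0 => x _; exact: profile_ge0.
have mG1 := measurable_EFin_gdens m a.
have mG2 : measurable_fun [set: R] (fun x => (gdens m a (- x))%:E).
  by apply: (measurableT_comp mG1); exact: oppr_measurable.
have a0 := a_gt0.
apply: (@le_lt_trans _ _
    (\int[mu]_x ((gdens m a x)%:E + (gdens m a (- x))%:E))%E).
  apply: integralT_ge0_le_off0.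
  - exact: measurable_profile.
  - exact: emeasurable_funD.
  - exact: profile_ge0.
  move=> x; rewrite neq_lt => /orP[x0|x0].
    rewrite -(radially_nonincreasing_even x profile_radial).
    by rewrite profile_gdens ?oppr_gt0// -EFinD lee_fin lerDr gdens_ge0.
  by rewrite profile_gdens// -EFinD lee_fin lerDl gdens_ge0.
rewrite integralT_ge0D//; last 2 first.
- by move=> x; rewrite lee_fin gdens_ge0.
- by move=> x; rewrite lee_fin gdens_ge0.
rewrite (ge0_integral_opp mG1); last by move=> x; rewrite lee_fin gdens_ge0.
by rewrite integral_gdens// gammaeE// -EFinM -EFinD ltry.
Qed.

Lemma L1norm_ge0 : 0 <= M.
Proof.
by rewrite -lee_fin -L1normE integral_ge0// => x _; exact: profile_ge0.
Qed.

Lemma convpowS n : convpow f n.+2 = convolution f (convpow f n.+1).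
Proof. by []. Qed.

Lemma convpow_basics n :
  [/\ forall x, (0 <= convpow f n.+1 x)%E,
      measurable_fun [set: R] (convpow f n.+1),
      radially_nonincreasing (convpow f n.+1)
    & (\int[mu]_x convpow f n.+1 x = (M ^+ n.+1)%:E)%E].
Proof.
have mf := measurable_profile; have f0 := profile_ge0; have rf := profile_radial.
elim: n => [|n [c0 mc rc ic]].
  by split => //; rewrite expr1 -L1normE.
rewrite convpowS; split.
- by move=> x; exact: convolution_ge0.
- exact: measurable_convolution.
- exact: convolution_radially_nonincreasing.
- by rewrite integral_convolution// ic L1normE -EFinM -exprS.
Qed.

(** The [k]-fold convolution power of the restriction of the profile to the
    positive half-line. As [1 / Gamma 0 = 0], it vanishes for [k = 0], so that
    binomial sums can start at [0]. *)
Definition onesided (k : nat) (x : R) : R :=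
  Gamma a ^+ k * rGamma (a * k%:R) * gdens m (a * k%:R) x.

Lemma rGamma_ge0 (s : R) : 0 <= s -> 0 <= rGamma s.
Proof.
rewrite /rGamma le_eqVlt eq_sym; case: eqVneq => //= s0 s_gt0.
by rewrite invr_ge0 ltW// Gamma_gt0.
Qed.

Lemma Gamma_a_gt0 : 0 < Gamma a.
Proof. exact: Gamma_gt0 a_gt0. Qed.

Lemma onesided_ge0 k x : 0 <= onesided k x.
Proof.
rewrite mulr_ge0 ?gdens_ge0// mulr_ge0 ?exprn_ge0 ?(ltW Gamma_a_gt0)//.
by rewrite rGamma_ge0// mulr_ge0// ltW// a_gt0.
Qed.

Lemma onesided0 x : onesided 0 x = 0.
Proof. by rewrite /onesided /rGamma mulr0 eqxx mulr0 mul0r. Qed.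

Lemma onesided1 x : onesided 1 x = gdens m a x.
Proof.
rewrite /onesided expr1 mulr1 /rGamma gt_eqF ?a_gt0//.
by rewrite divff ?mul1r// gt_eqF// Gamma_a_gt0.
Qed.

Lemma measurable_onesided k : measurable_fun [set: R] (onesided k).
Proof. by apply: measurable_funM => //; exact: measurable_gdens. Qed.

Lemma convolution_onesided k x :
  convolution (fun y => (gdens m a y)%:E) (fun y => (onesided k.+1 y)%:E) x =
  (onesided k.+2 x)%:E.
Proof.
have a0 := a_gt0.
have ak0 : 0 < a * k.+1%:R by rewrite mulr_gt0// ltr0n.
rewrite /convolution; under eq_integral do rewrite EFinM muleCA.
rewrite integralT_ge0Zl; last 3 first.
- by rewrite mulr_ge0 ?exprn_ge0 ?(ltW Gamma_a_gt0)// rGamma_ge0// ltW.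
- exact: (measurable_convolution_section x (measurable_EFin_gdens m a)
    (measurable_EFin_gdens m (a * k.+1%:R))).
- by move=> y; rewrite -EFinM lee_fin mulr_ge0 ?gdens_ge0.
rewrite -/(convolution (fun y => (gdens m a y)%:E)
  (fun y => (gdens m (a * k.+1%:R) y)%:E) x).
rewrite convolution_gdens// -EFinM; congr EFin.
rewrite /onesided /rGamma !gt_eqF ?mulr_gt0 ?ltr0n//.
have -> : a * k.+2%:R = a + a * k.+1%:R by rewrite -[in LHS]natr1; ring.
rewrite [in RHS]exprS.
have := Gamma_gt0 ak0; have := Gamma_gt0 (addr_gt0 a0 ak0).
move: (Gamma (a * _)) (Gamma (_ + _)) (Gamma a ^+ _) (gdens _ _ _).
move=> u v w d v0 u0.
by field; rewrite !gt_eqF.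
Qed.

End profile_convolutions.

Section convpow_bounds.
Context {R : realType}.
Local Notation mu := (@lebesgue_measure R).
Variables (m g : R).
Hypotheses (m_gt0 : 0 < m) (g_ge0 : 0 <= g) (g_lt1 : g < 1).
Local Notation f := (profile m g).
Local Notation a := (1 - g).
Local Notation M := (L1norm f).
Local Notation H := (onesided m g).
Local Notation h := (fun y => (gdens m a y)%:E).

Let mh : measurable_fun [set: R] h := measurable_EFin_gdens m a.
Let mH k : measurable_fun [set: R] (fun y => (H k y)%:E).
Proof. by apply/measurable_EFinP; exact: measurable_onesided. Qed.
Let H_ge0 k x : (0 <= (H k x)%:E)%E.
Proof. by rewrite lee_fin onesided_ge0. Qed.
Let h_ge0 x : (0 <= h x)%E.
Proof. by rewrite lee_fin gdens_ge0. Qed.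

(** Restricting the profile to the positive half-line can only decrease its
    convolution powers. *)
Lemma convpow_ge n x : ((H n.+1 x)%:E <= convpow f n.+1 x)%E.
Proof.
elim: n x => [|n IH] x; first by rewrite onesided1//; exact: gdens_le_profile.
have [c0 mc _ _] := convpow_basics m_gt0 g_ge0 g_lt1 n.
rewrite convpowS -convolution_onesided//; apply: le_convolution => //.
- exact: measurable_profile.
- by move=> y; exact: gdens_le_profile.
Qed.

(** The upper bound, and its coefficients once the vanishing term [k = 0] is
    removed. *)
Let B n x := binomial_transform M (H ^~ x) n.

Let c n k : R := 'C(n, k.+1)%:R * M ^+ (n - k.+1).

Let M_ge0 : 0 <= M := L1norm_ge0 m_gt0 g_ge0 g_lt1.

Let c_ge0 n k : 0 <= c n k.
Proof. by rewrite mulr_ge0// exprn_ge0. Qed.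

Let BE n x : B n x = \sum_(k < n) c n k * H k.+1 x.
Proof.
rewrite /B /binomial_transform big_ord_recl onesided0 mulr0 add0r.
by apply: eq_bigr => i _.
Qed.

Let B_ge0 n x : 0 <= B n x.
Proof. by rewrite BE sumr_ge0// => k _; rewrite mulr_ge0// -lee_fin. Qed.

Let mB n : measurable_fun [set: R] (fun y => (B n y)%:E).
Proof.
apply/measurable_EFinP.
apply: (eq_measurable_fun (fun x => \sum_(k < n) c n k * H k.+1 x)).
  by move=> x _; rewrite BE.
apply: measurable_sum => k; apply: measurable_funM => //.
exact: measurable_onesided.
Qed.

Let convolution_B n x :
  convolution h (fun y => (B n y)%:E) x = (\sum_(k < n) c n k * H k.+2 x)%:E.
Proof.
rewrite /convolution.
transitivity (\int[mu]_y
    \sum_(k < n) ((c n k)%:E * (h (x - y)%R * (H k.+1 y)%:E)))%E.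
  apply: eq_integral => y _; rewrite BE -EFinM mulr_sumr -sumEFin.
  by apply: eq_bigr => k _; rewrite -!EFinM mulrCA.
rewrite ge0_integral_sum//; last 2 first.
- move=> k; apply: emeasurable_funM => //.
  exact: (measurable_convolution_section x mh (mH _)).
- by move=> k y _; apply: mule_ge0; [rewrite lee_fin|exact: mule_ge0].
rewrite -sumEFin; apply: eq_bigr => k _.
rewrite integralT_ge0Zl//; last 2 first.
- exact: (measurable_convolution_section x mh (mH _)).
- by move=> y; exact: mule_ge0.
by rewrite -/(convolution h (fun y => (H k.+1 y)%:E) x) convolution_onesided.
Qed.

(** In the convolution of the profile [f] with its power [F], evaluated at
    [x > 0], three regions are treated separately. For [y >= x], [F y <= F x]
    because [F] is radially nonincreasing, so the contribution is at most
    [M F x]; for [0 < y < x], the induction hypothesis is convolved with the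
    one-sided density; for [y <= 0], [f (x - y) <= f x], which leaves at most
    [f x] times the mass of [F], a power of [M]. The three bounds add up to the
    next binomial sum by Pascal's rule. *)
Lemma convpow_le n x : 0 < x ->
  (convpow f n.+1 x <= (binomial_transform M (H ^~ x) n.+1)%:E)%E.
Proof.
elim: n x => [|n IH] x x0.
  rewrite -/(B _ _) BE big_ord_recl big_ord0 addr0 /c binn subnn mul1r mul1r.
  by rewrite onesided1// -[leLHS]/(f x) profile_gdens.
have [F0 mF rF iF] := convpow_basics m_gt0 g_ge0 g_lt1 n.
rewrite convpowS binomial_transformS.
set F := convpow f n.+1 in F0 mF rF iF IH *.
have mf := measurable_profile m g; have f0 := profile_ge0 m g.
have rf := @profile_radial _ m g m_gt0 g_ge0.
have mfx : measurable_fun [set: R] (fun y => f (x - y)).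
  by apply: (measurableT_comp mf); exact: measurable_funB.
pose G1 y := ((B n.+1 x)%:E * f (x - y))%E.
pose G2 y := (h (x - y)%R * (B n.+1 y)%:E)%E.
pose G3 y := ((gdens m a x)%:E * F y)%E.
have mG1 : measurable_fun [set: R] G1 by exact: emeasurable_funM.
have mG2 : measurable_fun [set: R] G2.
  exact: (measurable_convolution_section x mh (mB _)).
have mG3 : measurable_fun [set: R] G3 by exact: emeasurable_funM.
have G10 y : (0 <= G1 y)%E by rewrite mule_ge0// lee_fin.
have G20 y : (0 <= G2 y)%E by rewrite mule_ge0// lee_fin.
have G30 y : (0 <= G3 y)%E by rewrite mule_ge0// lee_fin.
(* [G1], [G2], [G3] dominate the integrand for [x <= y], [0 < y < x], [y <= 0]. *)
apply: (@le_trans _ _ (\int[mu]_y (G1 y + (G2 y + G3 y)))%E).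
  apply: integralT_ge0_le.
  - exact: (measurable_convolution_section x mf mF).
  - by apply: emeasurable_funD => //; exact: emeasurable_funD.
  - by move=> y; exact: mule_ge0.
  move=> y; have [y0|y0] := leP y 0.
    rewrite -[leLHS]add0e leeD// -[leLHS]add0e leeD//.
    rewrite /G3 -profile_gdens// lee_wpmul2r//; apply: rf.
    by rewrite !ger0_norm; lra.
  have [xy|yx] := leP x y.
    rewrite -[leLHS]adde0 leeD ?adde_ge0// /G1 muleC lee_wpmul2r//.
    by rewrite (le_trans _ (IH _ x0))// rF// !gtr0_norm.
  rewrite -[leLHS]add0e leeD// -[leLHS]adde0 leeD// /G2 profile_gdens; last lra.
  by rewrite lee_wpmul2l//; exact: IH.
rewrite integralT_ge0D//; last 2 first.
- exact: emeasurable_funD.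
- by move=> y; exact: adde_ge0.
rewrite integralT_ge0D// EFinD leeD//.
  rewrite integralT_ge0Zl//.
  by rewrite (ge0_integral_reflect x mf f0) L1normE// -EFinM mulrC.
rewrite -/(convolution h (fun y => (B n.+1 y)%:E) x) convolution_B.
rewrite integralT_ge0Zl ?gdens_ge0// iF -EFinM -EFinD lee_fin.
have -> : binomial_transform M (fun k => H k.+1 x) n.+1 =
    M ^+ n.+1 * gdens m a x + \sum_(k < n.+1) c n.+1 k * H k.+2 x.
  by rewrite /binomial_transform big_ord_recl bin0 mul1r onesided1.
by rewrite addrC lerD2r mulrC.
Qed.

End convpow_bounds.

(** * The Wright function *)

Lemma expR_ge_partial {R : realType} (y : R) N :
  0 <= y -> series (exp_coeff y) N <= expR y.
Proof.
move=> y0; rewrite /expR; apply: nondecreasing_cvgn_le; last first.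
  exact: is_cvg_series_exp_coeff.
apply: nondecreasing_series => k _ _; rewrite /exp_coeff.
by rewrite divr_ge0 ?exprn_ge0.
Qed.

Section wright_series.
Context {R : realType}.
Variable rho : R.
Hypothesis rho_gt0 : 0 < rho.

Definition wright_term (t : R) (n : nat) : R :=
  t ^+ n * rGamma (rho * n%:R + 0) / n`!%:R.

Lemma rGamma_le2 (s : R) : 0 <= s -> rGamma s <= 2.
Proof.
rewrite le_eqVlt eq_sym /rGamma; case: eqVneq => //= _ s0.
by rewrite -[leRHS]invrK lef_pV2 ?posrE ?invr_gt0 ?Gamma_gt0// Gamma_ge_half.
Qed.

Lemma wright_term_ge0 t n : 0 <= t -> 0 <= wright_term t n.
Proof.
move=> t0; rewrite divr_ge0// mulr_ge0 ?exprn_ge0// rGamma_ge0//.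
by rewrite addr0 mulr_ge0// ltW.
Qed.

Lemma wright_term_le t n : 0 <= t -> wright_term t n <= 2 * (t ^+ n / n`!%:R).
Proof.
move=> t0; rewrite /wright_term mulrAC mulrC ler_wpM2r ?divr_ge0 ?exprn_ge0//.
by rewrite rGamma_le2// addr0 mulr_ge0// ltW.
Qed.

Lemma wright_term0 t : wright_term t 0 = 0.
Proof. by rewrite /wright_term mulr0 addr0 /rGamma eqxx mulr0 mul0r. Qed.

Lemma is_cvg_wright_term t : 0 <= t -> cvgn (series (wright_term t)).
Proof.
move=> t0; apply: (@series_le_cvg _ _ (2 *: exp_coeff t)).
- by move=> n; exact: wright_term_ge0.
- by move=> n; rewrite fctE /= mulr_ge0// divr_ge0 ?exprn_ge0.
- by move=> n; rewrite fctE; exact: wright_term_le.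
- by apply: is_cvg_seriesZ; exact: is_cvg_series_exp_coeff.
Qed.

Lemma wright_ge_partial t n :
  0 <= t -> series (wright_term t) n <= wright rho 0 t.
Proof.
move=> t0; apply: nondecreasing_cvgn_le; last exact: is_cvg_wright_term.
by apply: nondecreasing_series => k _ _; exact: wright_term_ge0.
Qed.

Lemma wright_le_bound t c : 0 <= t -> (forall n, series (wright_term t) n <= c) ->
  wright rho 0 t <= c.
Proof.
by move=> t0 H; apply: limr_le; [exact: is_cvg_wright_term|exact: nearW].
Qed.

(** For small [t] the term [n = 1] dominates; the remaining ones are compared
    with the exponential series at [T]. *)
Lemma wright_small (T t : R) : 0 < t -> t <= T ->
  t * rGamma rho <= wright rho 0 t /\ wright rho 0 t <= t * (2 / T * expR T).
Proof.
move=> t0 tT; have T0 : 0 < T := lt_le_trans t0 tT.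
split.
  apply: le_trans (wright_ge_partial 2 (ltW t0)).
  rewrite seriesEord/= 2!big_ord_recr big_ord0 /= add0r wright_term0 add0r.
  by rewrite /wright_term expr1 mulr1 addr0 divr1.
apply: wright_le_bound => [|n]; first exact: ltW.
apply: (@le_trans _ _ (t * (2 / T) * series (exp_coeff T) n)).
  rewrite !seriesEnat/= mulr_sumr; apply: ler_sum => -[_|k _].
    by rewrite wright_term0 !mulr_ge0 ?invr_ge0 ?ltW// divr_gt0.
  apply: le_trans (wright_term_le _ (ltW t0)) _.
  have -> : t * (2 / T) * exp_coeff T k.+1 = 2 * (t * T ^+ k / k.+1`!%:R).
    have : (k.+1`!%:R : R) != 0 by rewrite pnatr_eq0 -lt0n fact_gt0.
    rewrite /exp_coeff /= exprS; move: (_`!%:R) => F F0.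
    by field; rewrite F0 gt_eqF.
  rewrite ler_wpM2l// ler_wpM2r// exprS (ler_wpM2l (ltW t0))//.
  by rewrite lerXn2r ?nnegrE ?(ltW t0) ?(ltW T0).
rewrite !mulrA ler_wpM2l ?mulr_ge0 ?invr_ge0 ?(ltW t0) ?(ltW T0)//.
exact: expR_ge_partial (ltW T0).
Qed.

End wright_series.

Section geometric_sums.
Context {R : realType}.

Lemma geometric_sum_rev_le (q : R) k : 0 <= q -> q < 1 ->
  \sum_(i < k.+1) q ^+ (k - i) <= (1 - q)^-1.
Proof.
move=> q0 q1; have d0 : 0 < 1 - q by rewrite subr_gt0.
elim: k => [|k IH].
  rewrite big_ord_recl big_ord0 subnn addr0 expr0.
  by rewrite -[leLHS]invr1 lef_pV2 ?posrE//; lra.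
rewrite big_ord_recr/= subnn expr0.
under eq_bigr => i _ do rewrite subSn ?leq_ord// exprS.
rewrite -mulr_sumr.
have -> : (1 - q)^-1 = q * (1 - q)^-1 + 1 by field; rewrite gt_eqF.
by rewrite lerD2r ler_wpM2l.
Qed.

Lemma geometric_sum_le (q : R) k : 0 <= q -> q < 1 ->
  \sum_(i < k) q ^+ i <= (1 - q)^-1.
Proof.
move=> q0 q1; case: k => [|k].
  by rewrite big_ord0 invr_ge0 subr_ge0 ltW.
apply: le_trans (geometric_sum_rev_le k q0 q1).
rewrite (reindex_inj rev_ord_inj)/=.
by under eq_bigr => i _ do rewrite subSS.
Qed.

(** Split the sum at the integer part of [s]: on each side the terms are
    dominated by a geometric sequence of ratio [q = e^(-1/c) <= c / (c + 1)]. *)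
Lemma laplace_sum_le (c s : R) N : 0 < c -> 0 <= s ->
  \sum_(n < N) expR (- (`|n%:R - s| / c)) <= 2 * (c + 1).
Proof.
move=> c0 s0; set q := expR (- c^-1).
have q0 : 0 <= q by exact: expR_ge0.
have cV : 0 < c^-1 by rewrite invr_gt0.
have q1 : q < 1 by rewrite expR_lt1 oppr_lt0.
have qV : (1 - q)^-1 <= c + 1.
  rewrite -[leRHS]invrK lef_pV2 ?posrE ?subr_gt0 ?invr_gt0//; last lra.
  have : q <= (1 + c^-1)^-1.
    by rewrite /q expRN lef_pV2 ?posrE ?expR_gt0 ?expR_ge1Dx//; lra.
  have -> : (1 + c^-1)^-1 = 1 - (c + 1)^-1 by field; rewrite !gt_eqF//=; lra.
  lra.
have qX j : q ^+ j = expR (- (j%:R / c)).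
  by rewrite /q -expRM_natr; congr expR; ring.
set k := Num.truncn s.
have [ks sk] : k%:R <= s /\ s < k.+1%:R.
  by split; [rewrite truncn_le|exact: truncnS_gt].
apply: (@le_trans _ _ (\sum_(n < k.+1 + N) expR (- (`|n%:R - s| / c)))).
  rewrite addnC big_split_ord/= lerDl sumr_ge0// => i _; exact: expR_ge0.
rewrite big_split_ord/= mulrDl mul1r lerD//.
  apply: le_trans qV; apply: le_trans (geometric_sum_rev_le k q0 q1).
  apply: ler_sum => i _; rewrite qX ler_expR lerN2 ler_pM2r//.
  rewrite natrB ?leq_ord// distrC; apply: le_trans (ler_norm _).
  by rewrite lerD2r.
apply: le_trans qV; apply: le_trans (geometric_sum_le N q0 q1).
apply: ler_sum => i _; rewrite qX ler_expR lerN2 ler_pM2r//.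
apply: le_trans (ler_norm _); rewrite natrD; lra.
Qed.

End geometric_sums.

Section wright_large_argument.
Context {R : realType}.
Variable rho : R.
Hypothesis rho_gt0 : 0 < rho.
Local Notation b := (1 + rho).
Local Notation w := (Num.sqrt rho).

(** The size of the [n]-th term of the series predicted by Stirling's
    formula; [saddle_sum] describes its peak, located at [n = s]. *)
Definition saddle_term (s : R) (n : nat) : R :=
  expR (b * (n%:R * ln (s / n%:R) + n%:R)).

Let w_gt0 : 0 < w. Proof. by rewrite sqrtr_gt0. Qed.
Let ww : w ^+ 2 = rho. Proof. by rewrite sqr_sqrtr// ltW. Qed.

(** The hypothesis says [t = s^(1 + rho) rho^rho]. Stirling's formula is used
    for [Gamma (rho n + 1) = rho n Gamma (rho n)] and for [n! = Gamma (n + 1)]: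
    the two square roots it produces cancel the factor [rho n], up to a
    constant, because [n >= 1]. *)
Lemma wright_term_saddle_term (s t : R) (n : nat) : 0 < s -> 0 < t -> (0 < n)%N ->
  ln t = b * ln s + rho * ln rho ->
  rho / (8 * expR 2 * (w + 1)) * saddle_term s n <= wright_term rho t n /\
  wright_term rho t n <= expR 2 * w * saddle_term s n.
Proof.
move=> s0 t0 n0 lnt; have w0 := w_gt0.
pose y : R := n%:R; have y0 : 0 < y by rewrite ltr0n.
pose q := Num.sqrt y; have q0 : 0 < q by rewrite sqrtr_gt0.
have qq : q ^+ 2 = y by rewrite sqr_sqrtr// ltW.
have q1 : 1 <= q by rewrite -sqrtr1 ler_wsqrtr// ler1n.
pose z := rho * y; have z0 : 0 < z by rewrite mulr_gt0.
have zz : (w * q) ^+ 2 = z by rewrite exprMn ww qq.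
have [Gz1 Gz2] := Gamma_stirling (mulr_gt0 w_gt0 q0).
have [Gy1 Gy2] := Gamma_stirling q0.
rewrite zz in Gz1 Gz2; rewrite qq /y natr1 Gamma_fact -/y in Gy1 Gy2.
set F := (n`!%:R : R) in Gy1 Gy2 *.
have F0 : 0 < F by rewrite ltr0n fact_gt0.
pose E := expR (z * ln z - z + (y * ln y - y)).
have E0 : 0 < E by exact: expR_gt0.
have tE : t ^+ n = saddle_term s n * E.
  rewrite -[t in LHS]lnK ?posrE// -expRM_natr -expRD lnt -/y.
  rewrite ln_div ?posrE// /z lnM ?posrE//; congr expR; ring.
have u0 : 0 < saddle_term s n by exact: expR_gt0.
set u := saddle_term s n in tE u0 *.
have wE : wright_term rho t n = u * E * z / (Gamma (z + 1) * F).
  rewrite /wright_term addr0 -/y -/z -/F tE /rGamma gt_eqF// GammaS//.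
  by have := Gamma_gt0 z0; move: (Gamma z) => G G0; field; rewrite !gt_eqF.
have P0 : 0 < Gamma (z + 1) * F by rewrite mulr_gt0// Gamma_gt0// addr_gt0.
have e20 : 0 < expR 2 :> R by exact: expR_gt0.
rewrite wE; split.
- rewrite ler_pdivlMr//.
  have PU : Gamma (z + 1) * F <= E * expR 2 * (4 * (w * q + 1) * (q + 1)).
    apply: le_trans (ler_pM (ltW (Gamma_gt0 _)) (ltW F0) Gz2 Gy2) _.
      by rewrite addr_gt0.
    rewrite le_eqVlt; apply/orP; left; apply/eqP.
    have -> : E * expR 2 = expR (z * ln z - z + 1) * expR (y * ln y - y + 1).
      by rewrite -!expRD; congr expR; ring.
    ring.
  (* [q >= 1] absorbs the additive constants [1]. *)
  apply: (@le_trans _ _ (rho / (8 * expR 2 * (w + 1)) * u *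
      (E * expR 2 * (4 * ((w + 1) * q) * (2 * q))))).
    rewrite ler_pM2l; last first.
      by rewrite mulr_gt0// divr_gt0// !mulr_gt0// addr_gt0.
    apply: le_trans PU _; rewrite ler_pM2l ?mulr_gt0//.
    have wq : 0 < w * q by rewrite mulr_gt0.
    by apply: ler_pM; [lra|lra|rewrite mulrDl; lra|lra].
  rewrite le_eqVlt; apply/orP; left; apply/eqP; rewrite /z -qq.
  by field; rewrite !gt_eqF// addr_gt0.
- rewrite ler_pdivrMr//.
  have PL : E * (w * y) <= expR 2 * (Gamma (z + 1) * F).
    apply: (@le_trans _ _ (expR 2 * (expR (z * ln z - z - 1) * (w * q) *
        (expR (y * ln y - y - 1) * q)))).
      have -> : E =
          expR 2 * (expR (z * ln z - z - 1) * expR (y * ln y - y - 1)).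
        by rewrite -!expRD; congr expR; ring.
      by rewrite le_eqVlt; apply/orP; left; apply/eqP; rewrite -qq; ring.
    rewrite ler_pM2l//; apply: ler_pM => //.
      by rewrite mulr_ge0 ?expR_ge0// mulr_ge0// ltW.
    by rewrite mulr_ge0 ?expR_ge0// ltW.
  have -> : u * E * z = u * w * (E * (w * y)) by rewrite /z -[in LHS]ww; ring.
  have -> : expR 2 * w * u * (Gamma (z + 1) * F) =
      u * w * (expR 2 * (Gamma (z + 1) * F)) by ring.
  by rewrite ler_pM2l ?mulr_gt0.
Qed.

(** Laplace's method. With [s = r^2], the terms are at most a two-sided
    exponential of height [e^(b s)] and scale [r + 1], whose sum is of order
    [r e^(b s)]; conversely, the first [r] or so indices above [s] give terms
    of order [e^(b s)]. The lower bound [r0 <= r] makes [r + 2] and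
    [(r + 1) / r] comparable to [r] and [1]. *)
Lemma wright_large (r0 : R) : 0 < r0 -> exists E3 E4 : R,
  [/\ 0 < E3, 0 < E4 & forall r t, r0 <= r -> 0 < t ->
    ln t = b * ln (r ^+ 2) + rho * ln rho ->
    E3 * (r * expR (b * r ^+ 2)) <= wright rho 0 t /\
    wright rho 0 t <= E4 * (r * expR (b * r ^+ 2))].
Proof.
move=> r00.
pose d := (1 + r0^-1) ^+ 2.
pose c1 := rho / (8 * expR 2 * (w + 1)); pose c2 := expR 2 * w.
have c10 : 0 < c1 by rewrite divr_gt0// !mulr_gt0 ?expR_gt0// addr_gt0.
have c20 : 0 < c2 by rewrite mulr_gt0 ?expR_gt0.
have r0V : 0 < r0^-1 by rewrite invr_gt0.
exists (c1 * expR (- (b * d))), (c2 * expR b * (2 * (1 + 2 * r0^-1))).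
split; [by rewrite mulr_gt0 ?expR_gt0|by rewrite !mulr_gt0 ?expR_gt0//; lra|].
move=> r t r0r t0 lnt.
have r_gt0 : 0 < r := lt_le_trans r00 r0r.
have s0 : 0 < r ^+ 2 by rewrite exprn_gt0.
have rV : r^-1 <= r0^-1 by rewrite lef_pV2.
have b1 : 1 <= b by rewrite lerDl ltW.
split; last first.
- apply: wright_le_bound => // [|N]; first exact: ltW.
  apply: (@le_trans _ _ (\sum_(n < N) c2 * expR b * expR (b * r ^+ 2) *
      expR (- (`|n%:R - r ^+ 2| / (r + 1))))).
    rewrite seriesEord/=; apply: ler_sum => -[[|n] nN] _ /=.
      by rewrite wright_term0 !mulr_ge0 ?expR_ge0// ltW.
    have [_ H] := wright_term_saddle_term s0 t0 (ltn0Sn n) lnt.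
    apply: le_trans H _; rewrite -/c2 /saddle_term.
    set D := `|_| / _.
    have -> : c2 * expR b * expR (b * r ^+ 2) * expR (- D) =
      c2 * expR (b + b * r ^+ 2 - D) by rewrite !expRD !mulrA.
    rewrite ler_pM2l// ler_expR.
    have n0 : 0 < n.+1%:R :> R by rewrite ltr0n.
    have := saddle_sum r_gt0 n0.
    rewrite -/D => H.
    have D0 : 0 <= D by rewrite divr_ge0//; lra.
    apply: le_trans (ler_wpM2l (le_trans ler01 b1) H) _.
    nra.
  rewrite -mulr_sumr.
  have cr : 0 < r + 1 by lra.
  have := laplace_sum_le N cr (ltW s0).
  set L := \sum_(_ < _) _ => HL.
  apply: (@le_trans _ _
      (c2 * expR b * expR (b * r ^+ 2) * (2 * (1 + 2 * r0^-1) * r))).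
    rewrite ler_pM2l ?mulr_gt0 ?expR_gt0//; apply: le_trans HL _.
    have : 1 <= r0^-1 * r by rewrite mulrC ler_pdivlMr// mul1r.
    nra.
  by rewrite le_eqVlt; apply/orP; left; apply/eqP; ring.
(* The [K >= r] indices following [k] lie between [s] and [s + r + 1]. *)
set k := Num.truncn (r ^+ 2); set K := (Num.truncn r).+1.
have [ks sk] : k%:R <= r ^+ 2 /\ r ^+ 2 < k.+1%:R.
  by split; [rewrite truncn_le ltW|exact: truncnS_gt].
apply: le_trans (wright_ge_partial rho_gt0 (k.+1 + K) (ltW t0)).
rewrite seriesEord/= big_split_ord/=.
apply: (@le_trans _ _ (\sum_(i < K) wright_term rho t (k.+1 + i))); last first.
  rewrite lerDr sumr_ge0// => i _; apply: wright_term_ge0 => //; exact: ltW.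
apply: (@le_trans _ _ (\sum_(i < K) c1 * expR (- (b * d)) * expR (b * r ^+ 2))).
  rewrite sumr_const card_ord -mulr_natr.
  rewrite [X in _ * X]mulrC mulrA ler_wpM2l ?mulr_ge0 ?expR_ge0 ?(ltW c10)//.
    exact: ltW.
  exact/ltW/truncnS_gt.
apply: ler_sum => i _.
have n0 : (0 < k.+1 + i)%N by [].
have [H _] := wright_term_saddle_term s0 t0 n0 lnt.
apply: le_trans H; rewrite -/c1 -mulrA ler_pM2l// -expRD ler_expR.
set y : R := (k.+1 + i)%:R.
have y0 : 0 < y by rewrite ltr0n.
have ys : r ^+ 2 <= y.
  by rewrite /y natrD; apply: le_trans (ltW sk) _; rewrite lerDl.
have yr : y - r ^+ 2 <= r + 1.
  have ir : i%:R <= r :> R.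
    apply: (@le_trans _ _ (Num.truncn r)%:R); last by rewrite truncn_le ltW.
    by rewrite ler_nat -ltnS ltn_ord.
  by rewrite /y natrD -natr1; lra.
have T := ler_wpM2l (ltW y0) (ln_tangent s0 y0).
have dy : (y - r ^+ 2) ^+ 2 / r ^+ 2 <= d.
  rewrite -expr_div_n ler_sqr ?nnegrE; last 2 first.
  - by rewrite divr_ge0 ?subr_ge0// ltW.
  - by rewrite addr_ge0// ltW.
  rewrite ler_pdivrMr//; apply: le_trans yr _.
  have : 1 <= r0^-1 * r by rewrite mulrC ler_pdivlMr// mul1r.
  nra.
have : r ^+ 2 - d <= y * ln (r ^+ 2 / y) + y.
  rewrite ln_div ?posrE//; apply: le_trans (lerB (lexx _) dy) _.
  have -> : r ^+ 2 - (y - r ^+ 2) ^+ 2 / r ^+ 2 = y + y - y * (y / r ^+ 2).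
    by field; rewrite gt_eqF.
  move: T; rewrite !mulrDr mulrN1; lra.
move=> /(ler_wpM2l (le_trans ler01 b1)); lra.
Qed.

End wright_large_argument.

(** * The compound Poisson density *)

Section finite_sums.
Context {R : realType}.

(** [C(N + 1, k) <= (N + 1) C(N, k)] for [k <= N], then the binomial
    theorem. *)
Lemma binomial_tail_le (M G : R) N : 0 <= M -> 0 <= G ->
  \sum_(k < N.+1) 'C(N.+1, k)%:R * M ^+ (N.+1 - k) * G ^+ k <=
  N.+1%:R * M * (M + G) ^+ N.
Proof.
move=> M0 G0; rewrite exprDn mulr_sumr; apply: ler_sum => k _.
have kN : (k <= N)%N by rewrite -ltnS.
rewrite subSn// exprS -[X in _ <= _ * X]mulr_natl.
have -> : 'C(N.+1, k)%:R * (M * M ^+ (N - k)) * G ^+ k =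
   'C(N.+1, k)%:R * (M * (M ^+ (N - k) * G ^+ k)) by ring.
have -> : N.+1%:R * M * ('C(N, k)%:R * (M ^+ (N - k) * G ^+ k)) =
   (N.+1%:R * 'C(N, k)%:R) * (M * (M ^+ (N - k) * G ^+ k)) by ring.
rewrite ler_wpM2r//; first by rewrite mulr_ge0// mulr_ge0 ?exprn_ge0.
rewrite -natrM ler_nat (mul_bin_down N.+1 k).
by rewrite leq_pmull// subn_gt0 ltnS.
Qed.

(** The left hand side sums over a triangle inside the square on the right. *)
Lemma cauchy_product_le (A B : nat -> R) N :
  (forall n, 0 <= A n) -> (forall n, 0 <= B n) ->
  \sum_(n < N) \sum_(k < n.+1) A k * B (n - k)%N <=
  (\sum_(k < N) A k) * (\sum_(j < N) B j).
Proof.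
move=> A0 B0.
suff -> : \sum_(n < N) \sum_(k < n.+1) A k * B (n - k)%N =
    \sum_(k < N) A k * \sum_(j < N - k) B j.
  rewrite mulr_suml; apply: ler_sum => k _; rewrite ler_wpM2l//.
  have kN : (N - k + k)%N = N by rewrite subnK// ltnW.
  rewrite -[in leRHS]kN big_split_ord/= lerDl sumr_ge0//.
elim: N => [|N IH]; first by rewrite !big_ord0.
rewrite big_ord_recr/= IH.
under [RHS]eq_bigr => k _ do rewrite subSn ?leq_ord// big_ord_recr/= mulrDr.
rewrite [RHS]big_split/=; congr (_ + _).
by rewrite [RHS]big_ord_recr/= subnn big_ord0 mulr0 addr0.
Qed.

Lemma le_ediv (c d : R) (x : \bar R) : 0 < d ->
  ((c * d)%:E <= x)%E -> (c%:E <= x / d%:E)%E.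
Proof. by move=> d0 H; rewrite inver gt_eqF// lee_pdivlMr. Qed.

Lemma ediv_le (c d : R) (x : \bar R) : 0 < d ->
  (x <= (c * d)%:E)%E -> (x / d%:E <= c%:E)%E.
Proof. by move=> d0 H; rewrite inver gt_eqF// lee_pdivrMr. Qed.

End finite_sums.

Section ratios.
Context {R : realType}.
Variables (m g : R).
Hypotheses (m_gt0 : 0 < m) (g_ge0 : 0 <= g) (g_lt1 : g < 1).
Local Notation f := (profile m g).
Local Notation a := (1 - g).
Local Notation M := (L1norm f).
Local Notation H := (onesided m g).

Let a0 : 0 < a := a_gt0 g_lt1.
Let G0 : 0 < Gamma a := Gamma_a_gt0 g_lt1.
Let M0 : 0 <= M := L1norm_ge0 m_gt0 g_ge0 g_lt1.

Lemma convpow_norm n x : convpow f n.+1 x = convpow f n.+1 `|x|.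
Proof.
have [_ _ rc _] := convpow_basics m_gt0 g_ge0 g_lt1 n.
by apply/le_anti; rewrite !rc ?normr_id.
Qed.

(** The common decay of the [n]-fold convolution power of the profile and of
    its one-sided part, as a function of [X = |x|]. *)
Definition leading_decay (n : nat) (X : R) : R :=
  expR (- m * X) * X `^ (a * n%:R - 1).

Lemma leading_decay_gt0 n X : 0 < X -> 0 < leading_decay n X.
Proof. by move=> X0; rewrite mulr_gt0 ?expR_gt0 ?powR_gt0. Qed.

Lemma onesidedE k X : 0 < X ->
  H k X = Gamma a ^+ k * rGamma (a * k%:R) * leading_decay k X.
Proof. by move=> X0; rewrite /onesided /gdens X0. Qed.

Lemma profile_leading_decay n x : x != 0 ->
  (f x * (`|x| `^ (a * (n%:R - 1)))%:E)%E = (leading_decay n `|x|)%:E.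
Proof.
move=> x0; rewrite profileE// -EFinM -mulrA -powRD; last first.
  by rewrite normr_eq0 x0 implybT.
by congr (_ * _ `^ _)%:E; ring.
Qed.

(** The term [k = n] of the binomial sum in [convpow_le] is the leading one.
    Since [X >= 1], each of the others carries a power of [X] at most
    [X^(-a)] times the leading one, and [1 / Gamma <= 2]. *)
Lemma convpow_le_lead (x : R) n : 1 <= `|x| ->
  (convpow f n.+1 x <= ((Gamma a ^+ n.+1 / Gamma (a * n.+1%:R) +
     2 * M * n.+1%:R * (M + Gamma a) ^+ n / `|x| `^ a) *
     leading_decay n.+1 `|x|)%:E)%E.
Proof.
move=> x1; have X0 : 0 < `|x| := lt_le_trans ltr01 x1.
rewrite convpow_norm; apply: le_trans (convpow_le m_gt0 g_ge0 g_lt1 n X0) _.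
rewrite lee_fin /binomial_transform big_ord_recr/= binn subnn !mul1r.
rewrite mulrDl addrC lerD//.
  by rewrite onesidedE// /rGamma gt_eqF// mulr_gt0.
pose D := expR (- m * `|x|) * `|x| `^ (a * n%:R - 1).
have D0 : 0 <= D by rewrite mulr_ge0 ?expR_ge0 ?powR_ge0.
have -> : 2 * M * n.+1%:R * (M + Gamma a) ^+ n / `|x| `^ a *
    leading_decay n.+1 `|x| = 2 * (n.+1%:R * M * (M + Gamma a) ^+ n) * D.
  have -> : leading_decay n.+1 `|x| = D * `|x| `^ a.
    rewrite /leading_decay /D -mulrA -powRD; last first.
      by rewrite (gt_eqF X0) implybT.
    by congr (_ * _ `^ _); rewrite -natr1; ring.
  by field; rewrite gt_eqF// powR_gt0.
apply: (@le_trans _ _ (2 * (\sum_(k < n.+1)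
    'C(n.+1, k)%:R * M ^+ (n.+1 - k) * Gamma a ^+ k) * D)); last first.
  by rewrite ler_wpM2r// ler_wpM2l// binomial_tail_le// ltW.
rewrite mulr_sumr mulr_suml; apply: ler_sum => k _.
have C0 : 0 <= 'C(n.+1, k)%:R * M ^+ (n.+1 - k) by rewrite mulr_ge0 ?exprn_ge0.
have ak0 : 0 <= a * k%:R by rewrite mulr_ge0// ltW.
rewrite onesidedE//.
have -> : 2 * ('C(n.+1, k)%:R * M ^+ (n.+1 - k) * Gamma a ^+ k) * D =
  'C(n.+1, k)%:R * M ^+ (n.+1 - k) * (Gamma a ^+ k * 2 * D) by ring.
rewrite ler_wpM2l//; apply: ler_pM.
- by rewrite mulr_ge0 ?exprn_ge0 ?rGamma_ge0 ?(ltW G0)//.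
- exact/ltW/leading_decay_gt0.
- by rewrite ler_wpM2l ?exprn_ge0 ?rGamma_le2// ltW.
- rewrite ler_wpM2l ?expR_ge0// ler_powR// lerD2r ler_wpM2l ?(ltW a0)//.
  by rewrite ler_nat -ltnS.
Qed.

Lemma convpow_ge_lead (x : R) n : x != 0 ->
  ((Gamma a ^+ n.+1 / Gamma (a * n.+1%:R) * leading_decay n.+1 `|x|)%:E <=
   convpow f n.+1 x)%E.
Proof.
rewrite -normr_gt0 => X0; rewrite convpow_norm.
apply: le_trans (convpow_ge m_gt0 g_ge0 g_lt1 n _).
by rewrite onesidedE// /rGamma gt_eqF// mulr_gt0.
Qed.

Lemma wright_term_onesided lam X n : 0 < X ->
  lam ^+ n * H n X / n`!%:R =
  expR (- m * X) * X^-1 * wright_term a (Gamma a * lam * X `^ a) n.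
Proof.
move=> X0; rewrite onesidedE// /leading_decay /wright_term addr0.
have -> : X `^ (a * n%:R - 1) = (X `^ a) ^+ n * X^-1.
  rewrite (@powRB _ X (a * n%:R) 1) ?(gt_eqF X0) ?implybT//.
  by rewrite powRrM powR_mulrn ?powR_ge0// powRr1 ?(ltW X0).
rewrite !exprMn; move: (X `^ a) => Y; ring.
Qed.

(** Summed against [lam^n / n!], the lower bound [onesided] gives the Wright
    series, and the binomial sums of [convpow_le] form the Cauchy product of
    that series with the exponential series of [M lam]. *)
Lemma cpoisson_bounds (x lam : R) : x != 0 -> 0 < lam ->
  let K := expR (- lam * M) * expR (- m * `|x|) * `|x|^-1 *
     wright a 0 (Gamma a * lam * `|x| `^ a) in
  (K%:E <= cpoisson f lam x)%E /\
  (cpoisson f lam x <= (expR (M * lam) * K)%:E)%E.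
Proof.
rewrite -normr_gt0; set X := `|x| => X0 lam0.
set t := Gamma a * lam * X `^ a; set W := wright a 0 t => K.
have t0 : 0 < t by rewrite !mulr_gt0 ?powR_gt0.
pose K0 := expR (- m * X) * X^-1.
have K00 : 0 < K0 by rewrite mulr_gt0 ?expR_gt0 ?invr_gt0.
pose p n : \bar R := ((lam ^+ n)%:E * convpow f n x / (n`!%:R)%:E)%E.
pose S := (\sum_(1 <= n <oo) p n)%E.
have fE n : ((n`!%:R)%:E^-1 = ((n`!%:R)^-1)%:E :> \bar R)%E.
  by rewrite inver gt_eqF// ltr0n fact_gt0.
have pE n : p n.+1 = ((lam ^+ n.+1 / n.+1`!%:R)%:E * convpow f n.+1 X)%E.
  by rewrite /p fE convpow_norm muleAC -EFinM.
have cf0 n : 0 <= lam ^+ n / n`!%:R by rewrite divr_ge0 ?exprn_ge0// ltW.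
have p0 n : (1 <= n)%N -> (0 <= p n)%E.
  case: n => // n _; rewrite pE mule_ge0 ?lee_fin//.
  by have [] := convpow_basics m_gt0 g_ge0 g_lt1 n.
have Sup : (S <= (K0 * W * expR (M * lam))%:E)%E.
  apply: lime_le; first by apply: is_cvg_nneseries => n n1 _; exact: p0.
  apply: nearW => N.
  pose A k := lam ^+ k * H k X / k`!%:R.
  pose B j := (M * lam) ^+ j / j`!%:R.
  have A0 k : 0 <= A k.
    by rewrite divr_ge0// mulr_ge0 ?exprn_ge0 ?(ltW lam0)// onesided_ge0.
  have B0 k : 0 <= B k by rewrite divr_ge0// exprn_ge0// mulr_ge0// ltW.
  apply: (@le_trans _ _ (\sum_(n < N) \sum_(k < n.+1) A k * B (n - k)%N)%:E).
    case: N => [|N]; first by rewrite big_geq// big_ord0.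
    rewrite big_add1/= big_mkord big_ord_recl/= EFinD -[leLHS]add0e leeD//.
      by rewrite lee_fin sumr_ge0// => i _; rewrite mulr_ge0.
    rewrite -sumEFin; apply: lee_sum => n _; rewrite /bump/= add1n pE.
    apply: le_trans (lee_wpmul2l _ (convpow_le m_gt0 g_ge0 g_lt1 n X0)) _.
      by rewrite lee_fin.
    rewrite -EFinM lee_fin /binomial_transform mulr_sumr.
    rewrite le_eqVlt; apply/orP; left; apply/eqP; apply: eq_bigr => k _.
    have kn : (k <= n.+1)%N by rewrite -ltnS.
    have Fn : (n.+1`!%:R : R) != 0 by rewrite pnatr_eq0 -lt0n fact_gt0.
    have Fk : (k`!%:R : R) != 0 by rewrite pnatr_eq0 -lt0n fact_gt0.
    have Fnk : ((n.+1 - k)`!%:R : R) != 0 by rewrite pnatr_eq0 -lt0n fact_gt0.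
    have bf : 'C(n.+1, k)%:R = n.+1`!%:R / (k`!%:R * (n.+1 - k)`!%:R) :> R.
      by rewrite -(bin_fact kn) natrM natrM mulfK// mulf_neq0.
    have le : lam ^+ n.+1 = lam ^+ k * lam ^+ (n.+1 - k).
      by rewrite -exprD subnKC.
    rewrite /A /B bf le exprMn.
    move: (n.+1`!%:R) (k`!%:R) ((n.+1 - k)`!%:R) Fn Fk Fnk => u v w u0 v0 w0.
    by field; rewrite u0 v0 w0.
  rewrite lee_fin; apply: le_trans (cauchy_product_le N A0 B0) _.
  apply: ler_pM; rewrite ?sumr_ge0//.
    rewrite /A; under eq_bigr do rewrite wright_term_onesided//.
    rewrite -mulr_sumr ler_pM2l//.
    have := wright_ge_partial a0 N (ltW t0); by rewrite seriesEord.
  have := expR_ge_partial N (mulr_ge0 M0 (ltW lam0)).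
  by rewrite seriesEord.
have Slow : ((K0 * W)%:E <= S)%E.
  have S0 : (0 <= S)%E by apply: nneseries_ge0 => n n1 _; exact: p0.
  have Sf : S \is a fin_num.
    by rewrite ge0_fin_numE//; apply: le_lt_trans Sup _; rewrite ltry.
  rewrite -(fineK Sf) lee_fin mulrC -ler_pdivlMr//.
  apply: wright_le_bound => // [|N]; first exact: ltW.
  rewrite ler_pdivlMr// mulrC -lee_fin (fineK Sf).
  apply: (@le_trans _ _ (\sum_(1 <= n < N) p n)%E); last first.
    by apply: nneseries_lim_ge => n n1 _; exact: p0.
  case: N => [|N]; first by rewrite seriesEord/= big_ord0 mulr0 big_geq.
  rewrite big_add1/= big_mkord seriesEord/= big_ord_recl wright_term0 add0r.
  rewrite mulr_sumr -sumEFin.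
  apply: lee_sum => n _; rewrite /= /bump /= add1n -wright_term_onesided// pE.
  rewrite mulrAC EFinM lee_wpmul2l ?lee_fin//; exact: convpow_ge.
have e0 : (0 <= (expR (- lam * M))%:E)%E by rewrite lee_fin expR_ge0.
rewrite /cpoisson -/S; split.
  rewrite /K -!mulrA EFinM lee_wpmul2l// mulrA; exact: Slow.
have -> : expR (M * lam) * K = expR (- lam * M) * (K0 * W * expR (M * lam)).
  rewrite /K /K0; ring.
by rewrite EFinM lee_wpmul2l.
Qed.

End ratios.

(** * Limits and uniform two-sided estimates *)

Section asymptotic_consequences.
Context {R : realType}.
Variables (m g : R).
Hypotheses (m_gt0 : 0 < m) (g_ge0 : 0 <= g) (g_lt1 : g < 1).
Local Notation f := (profile m g).
Local Notation a := (1 - g).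
Local Notation M := (L1norm f).

Let a0 : 0 < a := a_gt0 g_lt1.
Let G0 : 0 < Gamma a := Gamma_a_gt0 g_lt1.
Let M0 : 0 <= M := L1norm_ge0 m_gt0 g_ge0 g_lt1.

Lemma near_norm_pinfty_ge1 : \forall x \near norm_pinfty R, 1 <= `|x|.
Proof. by exists 1 => // x /= /ltW. Qed.

Lemma norm_pinfty_powR_cvg0 (s : R) : 0 < s ->
  `|x| `^ (- s) @[x --> norm_pinfty R] --> (0 : R).
Proof.
move=> s0; have H : `|x| @[x --> norm_pinfty R] --> +oo.
  by apply/cvgryPge => A; exists A => // x /= /ltW.
exact: (cvg_comp _ _ H (powR_cvgy0 s0)).
Qed.

(** Squeezed between the two bounds, as the error is of order [|x|^(-a)]. *)
Lemma convpow_ratio_cvg n :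
  (convpow f n.+1 x / (leading_decay m g n.+1 `|x|)%:E)%E
    @[x --> norm_pinfty R] -->
  (Gamma a ^+ n.+1 / Gamma (a * n.+1%:R))%:E.
Proof.
set l := _ / _; pose c := 2 * M * n.+1%:R * (M + Gamma a) ^+ n.
apply: (@squeeze_cvge _ _ _ _ (cst l%:E) _
  (fun x => (l + c * `|x| `^ (- a))%:E)).
- near=> x; have x1 : 1 <= `|x| by near: x; exact: near_norm_pinfty_ge1.
  have X0 : 0 < `|x| := lt_le_trans ltr01 x1.
  have d0 := leading_decay_gt0 m g n.+1 X0.
  apply/andP; split.
    by apply: le_ediv => //; apply: convpow_ge_lead; rewrite // -normr_gt0.
  by apply: ediv_le => //; rewrite powRN; exact: convpow_le_lead.
- exact: cvg_cst.
- apply: cvg_EFin; first exact: nearW.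
  rewrite -[X in _ --> X]addr0 -(mulr0 c); apply: cvgD; first exact: cvg_cst.
  by apply: cvgMr; exact: norm_pinfty_powR_cvg0.
Unshelve. all: end_near. Qed.

Lemma le_growth_const (C1 C2 : R) :
  growth_consts f C1 C2 -> M <= Num.max C1 C2 * M.
Proof. by move=> [C11 _ _ _]; rewrite ler_peMl// le_max C11. Qed.

(** Here the argument of the Wright function is at most [Gamma a], and
    [lam <= |x|^(-a) <= 1] bounds the factor [e^(M lam)] by [e^M]. *)
Lemma cpoisson_small : exists E1 E2 : R, [/\ 0 < E1, 0 < E2 &
  forall x lam : R, 1 <= `|x| -> 0 < lam -> lam * `|x| `^ a <= 1 ->
    let d := lam * expR (- lam * M) * expR (- m * `|x|) * `|x| `^ (- g) in
    ((E1 * d)%:E <= cpoisson f lam x)%E /\ (cpoisson f lam x <= (E2 * d)%:E)%E].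
Proof.
exists 1, (expR M * (2 * expR (Gamma a))); split => //.
  by rewrite !mulr_gt0 ?expR_gt0.
move=> x lam x1 lam0 lx; set X := `|x| in x1 lx *.
have X0 : 0 < X := lt_le_trans ltr01 x1.
have x0 : x != 0 by rewrite -normr_gt0.
have Y1 : 1 <= X `^ a by rewrite -[leLHS](powRr0 X) ler_powR// ltW.
have Y0 : 0 < X `^ a := lt_le_trans ltr01 Y1.
have lam1 : lam <= 1 by apply: le_trans lx; rewrite ler_peMr// ltW.
pose v := lam * X `^ a; have v0 : 0 < v by rewrite mulr_gt0.
have t0 : 0 < Gamma a * v by rewrite mulr_gt0.
have tT : Gamma a * v <= Gamma a by rewrite ler_piMr// ltW.
have [W1 W2] := wright_small a0 t0 tT.
have /= [P1 P2] := cpoisson_bounds m_gt0 g_ge0 g_lt1 x0 lam0.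
rewrite -/X -[Gamma a * lam * _]mulrA -/v in P1 P2.
set W := wright _ _ _ in W1 W2 P1 P2.
set e1 := expR (- lam * M) in P1 P2 *; set e2 := expR (- m * X) in P1 P2 *.
have e10 : 0 < e1 by exact: expR_gt0.
have e20 : 0 < e2 by exact: expR_gt0.
have dE : lam * e1 * e2 * X `^ (- g) = e1 * e2 * X^-1 * v.
  have -> : X `^ (- g) = X^-1 * X `^ a.
    rewrite (@powRB _ X 1 g) ?(gt_eqF X0) ?implybT// powRr1 ?(ltW X0)//.
    by rewrite mulrA mulVf ?gt_eqF// mul1r powRN.
  by rewrite /v; ring.
have k0 : 0 < e1 * e2 * X^-1 by rewrite !mulr_gt0 ?invr_gt0.
have W0 : 0 <= W.
  by apply: le_trans W1; apply: mulr_ge0; [exact: ltW|exact/rGamma_ge0/ltW].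
rewrite /= dE; split.
  apply: le_trans P1; rewrite lee_fin mul1r -!mulrA !ler_pM2l ?invr_gt0//.
  apply: le_trans W1; rewrite /rGamma gt_eqF//.
  by rewrite le_eqVlt; apply/orP; left; apply/eqP; field; rewrite gt_eqF.
apply: le_trans P2 _; rewrite lee_fin.
have -> : expR M * (2 * expR (Gamma a)) * (e1 * e2 * X^-1 * v) =
   expR M * ((e1 * e2 * X^-1) * (2 * expR (Gamma a) * v)) by ring.
apply: ler_pM; [exact: expR_ge0| |by rewrite ler_expR ler_piMr|].
  exact: mulr_ge0 (ltW k0) W0.
rewrite ler_pM2l//; apply: le_trans W2 _.
by rewrite le_eqVlt; apply/orP; left; apply/eqP; field; rewrite gt_eqF.
Qed.

(** With [v = lam |x|^a >= 1], [wright_large] is applied at the saddle point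
    [r^2 = (a Gamma(a) v)^(1/b) / a], where [b = 1 + a = 2 - g]; it lies above
    [kap^2], its value for [v = 1]. The rest is bookkeeping of exponents. *)
Lemma cpoisson_large : exists E3 E4 : R, [/\ 0 < E3, 0 < E4 &
  forall x lam : R, 1 <= `|x| -> 0 < lam -> 1 <= lam * `|x| `^ a ->
    let d := lam `^ (1 / (4 - 2 * g)) * `|x| `^ (- ((3 - g) / (4 - 2 * g)))
       * expR (- lam * M - m * `|x| + (2 - g) / (1 - g)
         * (Gamma (2 - g) * lam * `|x| `^ (1 - g)) `^ (1 / (2 - g))) in
    ((E3 * d)%:E <= cpoisson f lam x)%E /\
    (cpoisson f lam x <= (E4 * expR (M * lam) * d)%:E)%E].
Proof.
pose b : R := 1 + a; have b0 : 0 < b by rewrite addr_gt0.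
have G2 : Gamma (2 - g) = a * Gamma a.
  by rewrite -GammaS//; congr Gamma; ring.
pose q v : R := (a * Gamma a * v) `^ b^-1 / a.
pose kap : R := Num.sqrt (q 1).
have aG : 0 < a * Gamma a by rewrite mulr_gt0.
have q0 v : 0 < v -> 0 < q v by move=> v0; rewrite divr_gt0 ?powR_gt0// mulr_gt0.
have kap0 : 0 < kap by rewrite sqrtr_gt0 q0.
have [E3 [E4 [E30 E40 HE]]] := wright_large a0 kap0.
exists (E3 * kap), (E4 * kap); split; [exact: mulr_gt0|exact: mulr_gt0|].
move=> x lam x1 lam0 lx; set X := `|x| in x1 lx *.
have X0 : 0 < X := lt_le_trans ltr01 x1.
have x0 : x != 0 by rewrite -normr_gt0.
pose v := lam * X `^ a; have v0 : 0 < v by rewrite mulr_gt0 ?powR_gt0.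
pose r := kap * v `^ (2 * b)^-1.
have r2 : r ^+ 2 = q v.
  rewrite exprMn sqr_sqrtr ?(ltW (q0 _ _))// /q mulr1.
  rewrite -powR_mulrn ?powR_ge0// -powRrM.
  have -> : (2 * b)^-1 * 2 = b^-1 by field; rewrite gt_eqF.
  by rewrite (powRM _ (ltW aG) (ltW v0)) mulrAC.
have kr : kap <= r.
  rewrite ler_peMr ?(ltW kap0)// -[leLHS](powRr0 v) ler_powR// invr_ge0.
  by rewrite mulr_ge0// ltW.
have t0 : 0 < Gamma a * v by rewrite mulr_gt0.
have lnt : ln (Gamma a * v) = (1 + a) * ln (r ^+ 2) + a * ln a.
  have -> : ln (r ^+ 2) = b^-1 * (ln a + ln (Gamma a * v)) - ln a.
    rewrite r2 /q ln_div ?posrE ?powR_gt0 ?(mulr_gt0 aG v0)// ln_powR.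
    by rewrite -mulrA [ln (a * _)]lnM ?posrE.
  have bN0 : b != 0 by rewrite gt_eqF.
  rewrite -/b mulrBr [b * (b^-1 * _)]mulrA divff// mul1r.
  by rewrite /b; ring.
have [W1 W2] := HE r _ kr t0 lnt.
have /= [P1 P2] := cpoisson_bounds m_gt0 g_ge0 g_lt1 x0 lam0.
rewrite -/X -[Gamma a * lam * _]mulrA -/v in P1 P2.
set W := wright _ _ _ in W1 W2 P1 P2.
set d := _ * _ * expR _.
have dE : expR (- lam * M) * expR (- m * X) * X^-1 *
    (r * expR ((1 + a) * r ^+ 2)) = kap * d.
  have -> : d = X^-1 * v `^ (2 * b)^-1 *
      (expR (- lam * M) * expR (- m * X) * expR ((1 + a) * r ^+ 2)).
    rewrite /d -!expRD; congr (_ * expR _).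
      rewrite /v powRM ?(ltW lam0) ?powR_ge0// mulrCA -powRrM.
      rewrite -(@powR_inv1 _ X) ?(ltW X0)// -powRD ?(gt_eqF X0) ?implybT//.
      have b2 : 4 - 2 * g = 2 * b by rewrite /b; ring.
      rewrite b2 div1r; congr (_ * _ `^ _).
      have -> : 3 - g = 2 * b - a by rewrite /b; ring.
      by field; rewrite gt_eqF.
    rewrite r2 /q G2 -[a * Gamma a * lam * _]mulrA -/v div1r.
    have -> : 2 - g = b by rewrite /b; ring.
    rewrite -/b. by move: (_ `^ _) => w; ring.
  by rewrite /r; ring.
have k0 : 0 < expR (- lam * M) * expR (- m * X) * X^-1.
  by rewrite !mulr_gt0 ?expR_gt0 ?invr_gt0.
split.
  apply: le_trans P1; rewrite lee_fin -mulrA -dE mulrCA ler_pM2l//.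
apply: le_trans P2 _; rewrite lee_fin.
have -> : E4 * kap * expR (M * lam) * d =
    expR (M * lam) * (E4 * (kap * d)) by ring.
by rewrite ler_pM2l ?expR_gt0// -dE mulrCA ler_pM2l.
Qed.

End asymptotic_consequences.
Theorem theorem4p3 (R : realType) (m g : R) (hm : 0 < m)
    (hg0 : 0 <= g) (hg1 : g < 1) :
  let f := profile m g in
  let M2 (C1 C2 : R) : R := Num.max C1 C2 * L1norm f in
  let lead (n : nat) : R := Gamma (1 - g) ^+ n / Gamma ((1 - g) * n%:R) in
  [/\ (forall C1 C2 : R, growth_consts f C1 C2 ->
        forall (x : R) (n : nat), 1 <= `|x| -> (0 < n)%N ->
          let ratio :=
            (convpow f n x / (f x * (`|x| `^ ((1 - g) * (n%:R - 1)))%:E))%E in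
          ((lead n)%:E <= ratio)%E /\
          (ratio <= (lead n
             + 2 * M2 C1 C2 * n%:R * (M2 C1 C2 + Gamma (1 - g)) ^+ (n - 1)
               / `|x| `^ (1 - g))%:E)%E),
      (forall n : nat, (0 < n)%N ->
        (convpow f n x / (f x * (`|x| `^ ((1 - g) * (n%:R - 1)))%:E))%E
          @[x --> norm_pinfty R] --> (lead n)%:E /\
        (convpow f n x
          / (expR (- m * `|x|) * `|x| `^ ((1 - g) * n%:R - 1))%:E)%E
          @[x --> norm_pinfty R] --> (lead n)%:E),
      (forall C1 C2 : R, growth_consts f C1 C2 ->
        forall x lam : R, 1 <= `|x| -> 0 < lam ->
          let ratio :=
            (cpoisson f lam x
              / (expR (- lam * L1norm f) * expR (- m * `|x|) * `|x|^-1
                 * wright (1 - g) 0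
                     (Gamma (1 - g) * lam * `|x| `^ (1 - g)))%:E)%E in
          (1%:E <= ratio)%E /\ (ratio <= (expR (M2 C1 C2 * lam))%:E)%E)
    & exists E1 E2 E3 E4 : R,
        [/\ [/\ 0 < E1, 0 < E2, 0 < E3 & 0 < E4],
            (forall x lam : R, 1 <= `|x| -> 0 < lam ->
              lam * `|x| `^ (1 - g) <= 1 ->
              let ratio :=
                (cpoisson f lam x
                  / (lam * expR (- lam * L1norm f) * expR (- m * `|x|)
                     * `|x| `^ (- g))%:E)%E in
              (E1%:E <= ratio)%E /\ (ratio <= E2%:E)%E)
          & (forall C1 C2 : R, growth_consts f C1 C2 ->
              forall x lam : R, 1 <= `|x| -> 0 < lam ->
              1 <= lam * `|x| `^ (1 - g) ->
              let ratio :=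
                (cpoisson f lam x
                  / (lam `^ (1 / (4 - 2 * g))
                     * `|x| `^ (- ((3 - g) / (4 - 2 * g)))
                     * expR (- lam * L1norm f - m * `|x|
                             + (2 - g) / (1 - g)
                               * (Gamma (2 - g) * lam * `|x| `^ (1 - g))
                                   `^ (1 / (2 - g))))%:E)%E in
              (E3%:E <= ratio)%E /\ (ratio <= (E4 * expR (M2 C1 C2 * lam))%:E)%E)]].
Proof.
move=> f M2 lead.
have a0 : 0 < 1 - g by rewrite subr_gt0.
have G0 : 0 < Gamma (1 - g) by exact: Gamma_gt0.
have M0 : 0 <= L1norm f by exact: L1norm_ge0.
split.
- move=> C1 C2 gc x [//|n] x1 _ ratio.
  have X0 : 0 < `|x| := lt_le_trans ltr01 x1.
  have x0 : x != 0 by rewrite -normr_gt0.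
  have d0 := leading_decay_gt0 m g n.+1 X0.
  have MM : L1norm f <= M2 C1 C2 by exact: le_growth_const.
  rewrite /ratio profile_leading_decay//; split.
    by apply: le_ediv => //; exact: convpow_ge_lead.
  apply: ediv_le => //; apply: le_trans (convpow_le_lead hm hg0 hg1 n x1) _.
  rewrite lee_fin ler_pM2r// lerD2l ler_wpM2r ?invr_ge0 ?powR_ge0// subn1/=.
  apply: ler_pM.
  + by rewrite !mulr_ge0.
  + by rewrite exprn_ge0// addr_ge0// ltW.
  + by rewrite ler_wpM2r// ler_wpM2l.
  + rewrite lerXn2r ?nnegrE ?lerD2r// addr_ge0 ?(ltW G0)//.
    exact: le_trans MM.
- move=> [//|n] _; have H := @convpow_ratio_cvg _ _ _ hm hg0 hg1 n.
  split => //; apply: cvg_trans H; apply: near_eq_cvg; near=> x.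
  have x1 : 1 <= `|x| by near: x; exact: near_norm_pinfty_ge1.
  by rewrite profile_leading_decay// -normr_gt0 (lt_le_trans ltr01 x1).
- move=> C1 C2 gc x lam x1 lam0 ratio.
  have X0 : 0 < `|x| := lt_le_trans ltr01 x1.
  have x0 : x != 0 by rewrite -normr_gt0.
  have MM : L1norm f <= M2 C1 C2 by exact: le_growth_const.
  have [P1 P2] := cpoisson_bounds hm hg0 hg1 x0 lam0.
  have t0 : 0 < Gamma (1 - g) * lam * `|x| `^ (1 - g).
    by rewrite !mulr_gt0 ?powR_gt0.
  have [W1 _] := wright_small a0 t0 (lexx _).
  have W0 : 0 < wright (1 - g) 0 (Gamma (1 - g) * lam * `|x| `^ (1 - g)).
    by apply: lt_le_trans W1; rewrite mulr_gt0// /rGamma gt_eqF// invr_gt0.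
  rewrite /ratio; split.
    by apply: le_ediv; rewrite ?mul1r// !mulr_gt0 ?expR_gt0 ?invr_gt0.
  apply: ediv_le; first by rewrite !mulr_gt0 ?expR_gt0 ?invr_gt0.
  apply: le_trans P2 _; rewrite lee_fin ler_wpM2r//.
    by rewrite !mulr_ge0 ?expR_ge0 ?invr_ge0// ltW.
  by rewrite ler_expR ler_wpM2r// ltW.
have [E1 [E2 [E10 E20 HS]]] := cpoisson_small hm hg0 hg1.
have [E3 [E4 [E30 E40 HL]]] := cpoisson_large hm hg0 hg1.
exists E1, E2, E3, E4; split => //.
  move=> x lam x1 lam0 lx ratio; have [P1 P2] := HS x lam x1 lam0 lx.
  have X0 : 0 < `|x| := lt_le_trans ltr01 x1.
  have d0 : 0 < lam * expR (- lam * L1norm f) * expR (- m * `|x|) *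
      `|x| `^ (- g).
    by rewrite !mulr_gt0 ?expR_gt0 ?powR_gt0.
  by split; [exact: le_ediv|exact: ediv_le].
move=> C1 C2 gc x lam x1 lam0 lx ratio; have [P1 P2] := HL x lam x1 lam0 lx.
have X0 : 0 < `|x| := lt_le_trans ltr01 x1.
have MM : L1norm f <= M2 C1 C2 by exact: le_growth_const.
rewrite /ratio; set d := _ * _ * expR _.
have d0 : 0 < d by rewrite !mulr_gt0 ?expR_gt0 ?powR_gt0.
split; first exact: le_ediv.
apply: ediv_le => //; apply: le_trans P2 _.
rewrite lee_fin -/d ler_pM2r// ler_pM2l//.
by rewrite ler_expR ler_pM2r.
Unshelve. all: end_near. Qed.
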